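(* Let $\{x^k\}_{k\in\mathbb{N}}$ be an (infinite) sequence generated by Algorithm RiVMPL (described in the context) and assume that it is bounded. Let $\varsigma^*:=\lim_{k\to\infty}\Theta(x^k)$. If the function $\Xi$ defined in the context has the Kurdyka-Lojasiewicz (KL) property of exponent $q\in[\frac12,1)$ at every point of the set $W^*$ (the set of cluster points of $\{w^k\}_{k\in\mathbb{N}}$, defined in the context), then $\{x^k\}_{k\in\mathbb{N}}$ converges to some $x^*\in\Omega(x^0)$, where $\Omega(x^0)$ is the set of cluster points of $\{x^k\}_{k\in\mathbb{N}}$, and furthermore: (i) when $q=1/2$, there exist $\varrho,\widehat{\varrho}\in(0,1)$ and $\gamma_1>0$ such that for all sufficiently large $k$, $\Theta(x^k)-\varsigma^*\le\varrho(\Theta(x^{k-1})-\varsigma^* )$ and $\|x^k-x^*\|\le\gamma_1\widehat{\varrho}^{\,k}$; (ii) when $q\in(1/2,1)$, there exist $\gamma_1>0$ and $\gamma_2>0$ such that for all sufficiently large $k$, $\Theta(x^k)-\varsigma^*\le\gamma_1k^{\frac{1}{1-2q}}$ and $\|x^k-x^*\|\le\gamma_2k^{\frac{1-q}{1-2q}}$.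
   Context: Setting. $\mathbb{X},\mathbb{Z}$ are finite-dimensional real inner product spaces with induced norms $\|\cdot\|$; $\mathcal{M}\subset\mathbb{X}$ is a $\mathcal{C}^2$-smooth embedded closed submanifold with tangent spaces $T_x\mathcal{M}$ and tangent bundle $T\mathcal{M}=\{(x,d)\mid x\in\mathcal{M},d\in T_x\mathcal{M}\}$. The problem is $\min_{x\in\mathcal{M}}\Theta(x):=f(x)+\vartheta(F(x))$ under the standing assumptions: (i) $f:\mathbb{X}\to(-\infty,\infty]$ is proper, lower semicontinuous, and $\mathcal{C}^{1,1}$ (differentiable with locally Lipschitz gradient) on an open convex set $\mathcal{O}\supset\mathcal{M}$; (ii) $\vartheta:\mathbb{Z}\to\mathbb{R}$ is convex with a closed-form proximal mapping; (iii) $F:\mathbb{X}\to\mathbb{Z}$ is $\mathcal{C}^{1,1}$ on $\mathcal{O}$ (differentiable with locally Lipschitz derivative); (iv) $\inf_{x\in\mathcal{M}}\Theta(x)>-\infty$. $F'(x)$ is the differential, $\nabla F(x)$ its adjoint, and $\ell_F(x;z):=F(z)+F'(z)(x-z)$. $\mathcal{I}$ is the identity, $\|v\|_{\mathcal{Q}}^2:=\langle v,\mathcal{Q}v\rangle$, and $\delta_C$ is the indicator function of $C$. A retraction is a smooth map $R:T\mathcal{M}\to\mathcal{M}$ such that $R_x:=R(x,\cdot):T_x\mathcal{M}\to\mathcal{M}$ satisfies $R_x(0)=x$ and $R_x'(0)=\mathcal{I}$ for every $x\in\mathcal{M}$. Algorithm RiVMPL. Input: a retraction $R$, parameters $0<\alpha_{\min}\le\alpha_{\max}$,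 $\mu_{\max}>0$, $\overline{\alpha}>0$, $\overline{\gamma}>0$, $\sigma>1$, and $x^0\in\mathcal{M}$. For $k=0,1,2,\ldots$: choose $\alpha_{k,0}\in[\alpha_{\min},\alpha_{\max}]$ and $\mu_k\in(0,\mu_{\max}]$. Inner loop, $j=0,1,2,\ldots$: choose a self-adjoint linear operator $\mathcal{Q}_{k,j}:\mathbb{X}\to\mathbb{X}$ with $\alpha_{k,j}\mathcal{I}\preceq\mathcal{Q}_{k,j}\preceq(\overline{\alpha}+\alpha_{k,j})\mathcal{I}$; let $$\Theta_{k,j}(v):=\langle\nabla f(x^k),v\rangle+\tfrac12\|v\|^2_{\mathcal{Q}_{k,j}}+\vartheta(\ell_F(x^k+v;x^k))+f(x^k)$$ and let $\overline{v}^{k,j}$ be its unique minimizer over $v\in T_{x^k}\mathcal{M}$; find $(v^{k,j},\Theta^{\rm LB}_{k,j})\in T_{x^k}\mathcal{M}\times(-\infty,\Theta_{k,j}(\overline{v}^{k,j})]$ with $\Theta_{k,j}(v^{k,j})\le\Theta_{k,j}(0)$ and $\Theta_{k,j}(v^{k,j})-\Theta^{\rm LB}_{k,j}\le\frac{\mu_k}{2}\|v^{k,j}\|^2$. If $\Theta(R_{x^k}(v^{k,j}))\le\Theta_{k,j}(v^{k,j})-\frac{\overline{\gamma}}{2}\|v^{k,j}\|^2$ or $\|v^{k,j}\|=0$, leave the inner loop; else set $\alpha_{k,j+1}:=\sigma\alpha_{k,j}$ and continue it. After the inner loop: if $\|v^{k,j}\|=0$, stop; else set $j_k:=j$, $v^k:=v^{k,j_k}$,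 $\overline{v}^k:=\overline{v}^{k,j_k}$, $\mathcal{Q}_k:=\mathcal{Q}_{k,j_k}$, $\Theta_k:=\Theta_{k,j_k}$, $x^{k+1}:=R_{x^k}(v^k)$. When $\{x^k\}$ is bounded, there is $b_\alpha>0$ with $\alpha_{k,j}\le b_\alpha$ for all $k$ and $j\in\{0,\ldots,j_k\}$; fix one and put $\alpha^*:=b_\alpha+\overline{\alpha}$. The sequence $\{\Theta(x^k)\}$ converges. The function $\Xi$. Fix orthonormal bases $\{e_i\}_{i=1}^p$ of $\mathbb{X}$ and $\{d_i\}_{i=1}^r$ of $\mathbb{Z}$; let $\mathcal{E}^\dagger:\mathbb{X}\to\mathbb{R}^p$, $\mathcal{E}^\dagger x=(\langle e_1,x\rangle,\ldots,\langle e_p,x\rangle)^\top$, and $\mathcal{F}:\mathbb{R}^r\to\mathbb{Z}$, $\mathcal{F}\widehat{z}=\sum_i\widehat{z}_id_i$. Let $Q^k\in\mathbb{R}^{r\times p}$ be the matrix of $F'(x^k)$ in these bases, so $F'(x^k)v=\mathcal{F}Q^k\mathcal{E}^\dagger v$. For $w=(x,v,Q,s)\in\mathbb{W}:=\mathbb{X}\times\mathbb{X}\times\mathbb{R}^{r\times p}\times\mathbb{X}$, $$\Xi(w):=f(x)+\langle s,v\rangle+\vartheta(F(x)+\mathcal{F}Q\mathcal{E}^\dagger v)+\delta_{T\mathcal{M}}(x,v)+\tfrac{\alpha^*}{2}\|v\|^2.$$ Put $w^k:=(x^k,\overline{v}^k,Q^k,\nabla f(x^k))$ and let $W^*$ be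 the set of cluster points of $\{w^k\}_{k\in\mathbb{N}}$. KL property of exponent $q\in[0,1)$. A proper lsc $h$ has it at $\overline{x}\in{\rm dom}\,\partial h$ ($\partial$ the limiting subdifferential) if there are $c>0$, $\delta>0$, $\varpi\in(0,\infty]$ with $c(1-q)\,{\rm dist}(0,\partial h(x))\ge(h(x)-h(\overline{x}))^q$ for all $x$ with $\|x-\overline{x}\|\le\delta$ and $h(\overline{x})<h(x)<h(\overline{x})+\varpi$. *)

(* Defs.v *)
From HB Require Import structures.
From mathcomp Require Import all_boot all_order all_algebra.
From mathcomp Require Import all_classical all_reals all_analysis.

Set Implicit Arguments.
Unset Strict Implicit.
Unset Printing Implicit Defensive.

Import Order.TTheory GRing.Theory Num.Theory.
Import numFieldNormedType.Exports.

Local Open Scope classical_set_scope.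
Local Open Scope ring_scope.

(* A finite-dimensional real inner product space is a normedModType over
   R : realType with a positive definite symmetric form [dot] inducing its norm
   and with a finite orthonormal basis, which also carries the
   finite-dimensionality. *)
Section InnerProduct.
Variables (R : realType) (E : lmodType R) (dot : E -> E -> R).

Definition dnorm (x : E) : R := Num.sqrt (dot x x).

Definition orthonormal_basis (p : nat) (e : 'I_p -> E) : Prop :=
  (forall i j, dot (e i) (e j) = (i == j)%:R) /\
  (forall x, exists c : 'I_p -> R, x = \sum_i c i *: e i).

Definition coords (p : nat) (e : 'I_p -> E) (x : E) : 'cV[R]_p :=
  \col_i dot (e i) x.

End InnerProduct.

Definition norm_from (R : realType) (E : normedModType R) (dot : E -> E -> R) :
  Prop := forall x, `|x| = dnorm dot x.

Definition combine (R : realType) (E : lmodType R) (r : nat) (d : 'I_r -> E)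
  (z : 'cV[R]_r) : E := \sum_i z i 0 *: d i.

Section Smoothness.
Variables (R : realType) (V W : normedModType R).

(* f is of class C^k on the open set U. In finite dimension, continuity of the
   differential is continuity of x |-> 'd f x v for every v. *)
Fixpoint Ck (k : nat) (U : set V) (f : V -> W) : Prop :=
  match k with
  | 0%N => forall x, U x -> {for x, continuous f}
  | k'.+1 => (forall x, U x -> differentiable f x) /\
             (forall v, Ck k' U (fun x => 'd f x v))
  end.

(* f is C^{1,1} on the open set O; the bound on `|'d f y v - 'd f z v| for all
   v is a bound on the operator norm of 'd f y - 'd f z, which for a real-valued
   f is the norm of the difference of the gradients. *)
Definition C11 (O : set V) (f : V -> W) : Prop :=
  (forall x, O x -> differentiable f x) /\
  (forall x, O x -> exists L : R, exists2 U : set V, nbhs x U &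
     forall y z v, U y -> U z ->
       `|'d f y v - 'd f z v| <= L * `|y - z| * `|v|).

End Smoothness.

Definition gradient (R : realType) (E : normedModType R) (dot : E -> E -> R)
    (f : E -> R^o) (x : E) : E :=
  xget 0 [set g | forall v, dot g v = 'd f x v].

Section Manifold.
Variables (R : realType) (X : normedModType R).
Implicit Types (M S U V : set X) (x d : X).

Definition linear_subspace S : Prop :=
  S 0 /\ forall (a : R) u v, S u -> S v -> S (a *: u + v).

(* phi : U -> V is a C^2 diffeomorphism, with inverse psi, straightening
   M `&` U onto V `&` S. *)
Definition slice_chart M S U V (phi psi : X -> X) : Prop :=
  [/\ open U /\ open V, Ck 2 U phi /\ Ck 2 V psi,
      (forall y, U y -> V (phi y) /\ psi (phi y) = y),
      (forall z, V z -> U (psi z) /\ phi (psi z) = z) &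
      (forall y, U y -> (M y <-> S (phi y)))].

(* The model subspace S is common to all the points, so that the dimension of
   the manifold is constant. *)
Definition C2_embedded_submanifold M : Prop :=
  exists2 S, linear_subspace S &
    forall x, M x -> exists U V (phi psi : X -> X),
      U x /\ slice_chart M S U V phi psi.

(* Velocities at x of the C^2 curves in M through x. *)
Definition tangent_space M x : set X := [set d |
  exists (eps : R) (c : R^o -> X),
    [/\ 0 < eps, Ck 2 [set t : R^o | `|t| < eps] c,
        (forall t : R, `|t| < eps -> M (c t)), c 0 = x &
        'd c (0 : R^o) (1 : R^o) = d]].

Definition tangent_bundle M : set (X * X) :=
  [set xd | M xd.1 /\ tangent_space M xd.1 xd.2].

(* Ret is only meaningful on the tangent bundle. Smoothness of a map on this
   subset of X * X means the existence of local smooth extensions to open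
   subsets of X * X; "smooth" is C^2, the class of M. *)
Definition retraction M (Ret : X -> X -> X) : Prop :=
  [/\ (forall x d, tangent_bundle M (x, d) -> M (Ret x d)),
      (forall xd, tangent_bundle M xd ->
         exists (U : set (X * X)) (G : X * X -> X),
           [/\ open U, U xd, Ck 2 U G &
               forall yu, U yu -> tangent_bundle M yu ->
                 Ret yu.1 yu.2 = G yu]),
      (forall x, M x -> Ret x 0 = x) &
      (* the differential of Ret x at 0 on the tangent space is the identity *)
      (forall x, M x -> forall eps : R, 0 < eps ->
         \forall d \near (0 : X), tangent_space M x d ->
           `|Ret x d - Ret x 0 - d| <= eps * `|d|)].

End Manifold.

(* The topology of E is that of the library, all metric quantities are taken
   with respect to [dot]. For the product space carrying the potential function
   below, the library norm is only equivalent to the norm induced by [dot]. *)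
Section Variational.
Variables (R : realType) (E : normedModType R) (dot : E -> E -> R).
Implicit Types (h : E -> \bar R) (x s : E).

Definition regular_subdiff h x : set E := [set s |
  h x \is a fin_num /\
  forall eps : R, 0 < eps -> \forall y \near x,
    (h x + (dot s (y - x) - eps * dnorm dot (y - x))%:E <= h y)%E].

Definition limiting_subdiff h x : set E := [set s |
  h x \is a fin_num /\
  exists y t : nat -> E,
    [/\ y @ \oo --> x, (h \o y) @ \oo --> h x, t @ \oo --> s &
        forall n, regular_subdiff h (y n) (t n)]].

(* +oo when the subdifferential is empty *)
Definition dist0_subdiff h x : \bar R :=
  ereal_inf [set (dnorm dot s)%:E | s in limiting_subdiff h x].

Definition KL_property (q : R) h (xbar : E) : Prop :=
  limiting_subdiff h xbar !=set0 /\
  exists (c delta : R) (varpi : \bar R),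
    [/\ 0 < c, 0 < delta, (0 < varpi)%E &
      forall x, dnorm dot (x - xbar) <= delta ->
        (h xbar < h x)%E -> (h x < h xbar + varpi)%E ->
        (((fine (h x - h xbar)) `^ q)%:E
           <= (c * (1 - q))%:E * dist0_subdiff h x)%E].

End Variational.

Section Problem.
Variables (R : realType) (X Z : normedModType R).
Variables (dotX : X -> X -> R) (dotZ : Z -> Z -> R).
Variables (f : X -> \bar R) (vt : Z -> R) (F : X -> Z) (M : set X).

Definition f_real : X -> R^o := fun x => fine (f x).

Definition grad_f : X -> X := gradient dotX f_real.

Definition Theta (x : X) : \bar R := (f x + (vt (F x))%:E)%E.

Definition standing_assumptions (O : set X) : Prop :=
  [/\ closed M /\ C2_embedded_submanifold M,
      [/\ open O, convex_set O & M `<=` O],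
      [/\ (forall x, f x != -oo%E), (exists x, f x != +oo%E),
          lower_semicontinuous f, (forall x, O x -> f x \is a fin_num) &
          C11 O f_real],
      convex_function setT vt &
      C11 O F /\ (-oo < ereal_inf [set Theta x | x in M])%E].

Definition linearization (x z : X) : Z := F z + 'd F z (x - z).

(* The model at the point x of O, with quadratic term given by Q. *)
Definition model (x : X) (Q : X -> X) (v : X) : R :=
  dotX (grad_f x) v + 2^-1 * dotX v (Q v) +
  vt (linearization (x + v) x) + f_real x.

(* An infinite run of the algorithm: x is the sequence of iterates, [jend k] is
   the index j_k at which the k-th inner loop ends, and LB k j is the lower
   bound computed with v k j. For j > jend k, the values at (k, j) are
   irrelevant. An infinite run never meets the stopping test, whence
   run_no_stop. *)
Record RiVMPL_run (Ret : X -> X -> X)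
    (amin amax mumax abar gbar sigma : R)
    (x : nat -> X) (mu : nat -> R) (alpha : nat -> nat -> R)
    (Q : nat -> nat -> {linear X -> X}) (vbar v : nat -> nat -> X)
    (LB : nat -> nat -> R) (jend : nat -> nat) : Prop := {
  run_amin : 0 < amin;
  run_amax : amin <= amax;
  run_mumax : 0 < mumax;
  run_abar : 0 < abar;
  run_gbar : 0 < gbar;
  run_sigma : 1 < sigma;
  run_x0 : M (x 0%N);
  run_alpha0 : forall k, amin <= alpha k 0%N <= amax;
  run_mu : forall k, 0 < mu k <= mumax;
  run_Qsym : forall k j, (j <= jend k)%N ->
    forall u w, dotX (Q k j u) w = dotX u (Q k j w);
  run_Qbounds : forall k j, (j <= jend k)%N -> forall u,
    alpha k j * dotX u u <= dotX u (Q k j u) <=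
      (abar + alpha k j) * dotX u u;
  run_vbar : forall k j, (j <= jend k)%N ->
    tangent_space M (x k) (vbar k j) /\
    forall u, tangent_space M (x k) u ->
      model (x k) (Q k j) (vbar k j) <= model (x k) (Q k j) u;
  run_v : forall k j, (j <= jend k)%N ->
    [/\ tangent_space M (x k) (v k j),
        LB k j <= model (x k) (Q k j) (vbar k j),
        model (x k) (Q k j) (v k j) <= model (x k) (Q k j) 0 &
        model (x k) (Q k j) (v k j) - LB k j <= mu k / 2 * `|v k j| ^+ 2];
  run_continue : forall k j, (j < jend k)%N ->
    [/\ ~ (Theta (Ret (x k) (v k j)) <=
           (model (x k) (Q k j) (v k j) - gbar / 2 * `|v k j| ^+ 2)%:E)%E,
        `|v k j| != 0 &
        alpha k j.+1 = sigma * alpha k j];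
  run_exit : forall k,
    (Theta (Ret (x k) (v k (jend k))) <=
       (model (x k) (Q k (jend k)) (v k (jend k))
          - gbar / 2 * `|v k (jend k)| ^+ 2)%:E)%E
    \/ `|v k (jend k)| = 0;
  run_no_stop : forall k, `|v k (jend k)| != 0;
  run_next : forall k, x k.+1 = Ret (x k) (v k (jend k))
}.

Variables (p r : nat) (e : 'I_p -> X) (d : 'I_r -> Z).

Definition potential_space : normedModType R :=
  (X * X * 'M[R]_(r, p) * X)%type.

Definition potential_dot (w w' : potential_space) : R :=
  let: (x, v, Q, s) := w in
  let: (x', v', Q', s') := w' in
  dotX x x' + dotX v v' + (\sum_i \sum_j Q i j * Q' i j) + dotX s s'.

Definition diff_matrix (x : X) : 'M[R]_(r, p) :=
  \matrix_(i, j) dotZ (d i) ('d F x (e j)).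

Definition potential (astar : R) (w : potential_space) : \bar R :=
  let: (x, v, Q, s) := w in
  (f x
   + (dotX s v + vt (F x + combine d (Q *m coords dotX e v)))%:E
   + (if `[< tangent_bundle M (x, v) >] then 0 else +oo)
   + (astar / 2 * dotX v v)%:E)%E.

Definition potential_iterate (x vbar : X) : potential_space :=
  (x, vbar, diff_matrix x, grad_f x).

End Problem.

(* Main.v *)
Require Import Defs.
From HB Require Import structures.
From mathcomp Require Import all_boot all_order all_algebra.
From mathcomp Require Import all_classical all_reals all_analysis.
From mathcomp Require Import ring lra.

Set Implicit Arguments.
Unset Strict Implicit.
Unset Printing Implicit Defensive.

Import Order.TTheory GRing.Theory Num.Theory.
Import numFieldNormedType.Exports.

Local Open Scope classical_set_scope.
Local Open Scope ring_scope.

(* Write Theta for the objective, vb^k for the exact minimizer of the subproblem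
   and a_k for the gap of Theta at x^k.

   The exit test gives a_k - a_{k+1} >= c |v^k|^2, and strong convexity of the
   model gives |vb^k| <= C |v^k|. By Hahn-Banach, the optimality condition of
   vb^k on the tangent space has a multiplier xi in the subdifferential of
     vartheta
   and a normal vector n of M at x^k. Differentiating the two equations of the
   tangent bundle in a slice chart, phi(x) in S and phi'(x) v in S, shows that
   (n + H, n) is normal to the tangent bundle at (x^k, vb^k) for some H of size
   O(|n| |vb^k|). This yields a regular subgradient of Xi at w^k of size
   O(|vb^k|), locally uniformly in x^k.

   Since Xi(w^k) dominates the optimal value of the model, a_{k+1} is at most
   Xi(w^k) - varsigma + O(|v^k|^2), and the KL inequality becomes
   a_{k+1}^q <= C |v^k|; the error term is absorbed because 2q >= 1. Together
   with the descent inequality and |x^{k+1} - x^k| <= L |v^k|, this gives the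
   rates by the classical recursion arguments. *)

(** * Inner product spaces of finite dimension *)

(** The obstacle is that the gradient of f and the adjoint of F' applied to xi are not small at x^k;
    only their sum is, up to Q_k vb^k, and only along the tangent space. A subgradient of Xi of size
    O(|vb^k|) therefore needs the normal cone of the tangent bundle: adding (n + H, n) cancels the
    large terms in the components x and v at once and leaves -Q_k vb^k in both. The variables Q and
    s of Xi stand for F'(x) and the gradient of f, which need not be differentiable; their own
    components of the subgradient are xi times vb^k and vb^k, small because vb^k is. The domination
    of the model by Xi(w^k) comes from the coefficient of |v|^2 in Xi, an upper bound for every Q_k.
    It is one-sided: Xi(w^k) may lie below varsigma, where the KL inequality is silent, and then
    a_{k+1} is bounded by the error term alone. Since the exit test compares Theta(x^{k+1}) with the
    model at x^k, KL at w^k speaks of a_{k+1}, not a_k, and the recursions carry this shift. *)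

Lemma cvg_fin_sum (R : realType) (W : normedModType R) (T : Type)
  (FF : set_system T) {filterF : Filter FF} (I : finType) (g : I -> T -> W)
  (l : I -> W) :
  (forall i, g i t @[t --> FF] --> l i) ->
  \sum_i g i t @[t --> FF] --> \sum_i l i.
Proof. by move=> gl; apply: cvg_big => // ; exact: add_continuous. Qed.

(** Stated for semidefinite forms because it serves both the inner product and the form
    [dot (Q u) w] of the quadratic term. *)
Lemma psd_cauchy_schwarz (R : realFieldType) (E : lmodType R) (b : E -> E -> R)
  (bC : forall u v, b u v = b v u)
  (bP : forall a u v w, b (a *: u + v) w = a * b u w + b v w)
  (b_ge0 : forall u, 0 <= b u u) (u v : E) :
  b u v ^+ 2 <= b u u * b v v.
Proof.
have bPr a x y w : b w (a *: x + y) = a * b w x + b w y.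
  by rewrite bC bP !(bC _ w).
have quad t : 0 <= t ^+ 2 * b u u + 2 * t * b u v + b v v.
  have := b_ge0 (t *: u + v); rewrite bP !bPr (bC v u).
  by congr (_ <= _); ring.
have [bu0|bu0] := eqVneq (b u u) 0.
  have [->|buv] := eqVneq (b u v) 0; first by rewrite bu0 expr0n mul0r.
  (* With [b u u = 0] the quadratic is affine in t, and this t gives it the value -1. *)
  have := quad (- (b v v + 1) / (2 * b u v)); rewrite bu0 mulr0 add0r.
  have -> : 2 * (- (b v v + 1) / (2 * b u v)) * b u v = - (b v v + 1) by field.
  by lra.
have bu_gt0 : 0 < b u u by rewrite lt_neqAle eq_sym bu0 b_ge0.
have := quad (- b u v / b u u).
have -> : (- b u v / b u u) ^+ 2 * b u u + 2 * (- b u v / b u u) * b u v + b v v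
   = (b u u * b v v - b u v ^+ 2) / b u u by field.
by rewrite pmulr_lge0 ?invr_gt0// subr_ge0.
Qed.

Section InnerProductSpace.
Variables (R : realType) (E : normedModType R) (dot : {dot E for idfun}).
Hypothesis normE : norm_from dot.

Lemma dotC (u v : E) : dot u v = dot v u.
Proof. by rewrite hermC expr0 mul1r. Qed.

Lemma dotP (a : R) (u v w : E) : dot (a *: u + v) w = a * dot u w + dot v w.
Proof. by rewrite linearDl linearZl_LR. Qed.

Lemma dotDl (u v w : E) : dot (u + v) w = dot u w + dot v w.
Proof. exact: linearDl. Qed.
Lemma dotDr (u v w : E) : dot w (u + v) = dot w u + dot w v.
Proof. exact: linearDr. Qed.
Lemma dotBl (u v w : E) : dot (u - v) w = dot u w - dot v w.
Proof. exact: linearBl. Qed.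
Lemma dotBr (u v w : E) : dot w (u - v) = dot w u - dot w v.
Proof. exact: linearBr. Qed.
Lemma dotZl (a : R) (u w : E) : dot (a *: u) w = a * dot u w.
Proof. exact: linearZl_LR. Qed.
Lemma dotZr (a : R) (u w : E) : dot w (a *: u) = a * dot w u.
Proof. exact: linearZr_LR. Qed.

Lemma dot_sumr (I : finType) (u : I -> E) (w : E) :
  dot w (\sum_i u i) = \sum_i dot w (u i).
Proof. exact: linear_sumr. Qed.

Lemma dot_suml (I : finType) (u : I -> E) (w : E) :
  dot (\sum_i u i) w = \sum_i dot (u i) w.
Proof. by rewrite dotC dot_sumr; apply: eq_bigr => i _; rewrite dotC. Qed.

Lemma dot_ge0 (u : E) : 0 <= dot u u.
Proof.
have [->|/neq0_dnorm_gt0 h] := eqVneq u 0; first by rewrite linear0l.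
exact: ltW.
Qed.

Lemma dot_norm (u : E) : dot u u = `|u| ^+ 2.
Proof. by rewrite normE /dnorm sqr_sqrtr// dot_ge0. Qed.

Lemma cauchy_schwarz (u v : E) : `|dot u v| <= `|u| * `|v|.
Proof.
rewrite -(@ler_pXn2r _ 2)// ?nnegrE ?mulr_ge0// exprMn -!dot_norm -normrX.
rewrite ger0_norm ?sqr_ge0//.
by apply: psd_cauchy_schwarz dotC dotP dot_ge0 _ _.
Qed.

Section Basis.
Variables (p : nat) (e : 'I_p -> E).
Hypothesis basis : orthonormal_basis dot e.

Lemma basis_expansion (x : E) : x = \sum_i dot (e i) x *: e i.
Proof.
have [on /(_ x)[c ->]] := basis; apply: eq_bigr => i _; congr (_ *: _).
rewrite dot_sumr (bigD1 i)//= dotZr on eqxx mulr1 big1 ?addr0// => j ji.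
by rewrite dotZr on eq_sym (negbTE ji) mulr0.
Qed.

Lemma norm_basis i : `|e i| = 1.
Proof. by rewrite normE /dnorm basis.1 eqxx sqrtr1. Qed.

Lemma norm_coord i x : `|dot (e i) x| <= `|x|.
Proof. by apply: le_trans (cauchy_schwarz _ _) _; rewrite norm_basis mul1r. Qed.

Lemma linear_basis (W : normedModType R) (L : {linear E -> W}) x :
  L x = \sum_i dot (e i) x *: L (e i).
Proof.
rewrite {1}(basis_expansion x) linear_sum.
by apply: eq_bigr => i _; rewrite linearZ.
Qed.

Lemma linear_le (W : normedModType R) (L : {linear E -> W}) x :
  `|L x| <= (\sum_i `|L (e i)|) * `|x|.
Proof.
rewrite linear_basis (le_trans (ler_norm_sum _ _ _))// mulr_suml.
by apply: ler_sum => i _; rewrite normrZ mulrC ler_wpM2l// norm_coord.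
Qed.

Lemma linear_fin_continuous (W : normedModType R) (L : {linear E -> W}) :
  continuous L.
Proof.
move=> x; apply/cvgrPdist_le => eps eps0.
set C := \sum_i `|L (e i)|.
have C0 : 0 <= C by apply: sumr_ge0.
near=> y; rewrite -linearB; apply: le_trans (linear_le _ _) _.
rewrite (@le_trans _ _ ((C + 1) * `|x - y|))//.
  by rewrite ler_wpM2r// lerDl.
rewrite -ler_pdivlMl; last by rewrite ltr_wpDl.
near: y; apply: cvgr_dist_le; first exact: cvg_id.
by rewrite mulr_gt0// invr_gt0 ltr_wpDl.
Unshelve. all: by end_near. Qed.

Lemma riesz (L : E -> R) : (forall a u v, L (a *: u + v) = a * L u + L v) ->
  exists g, forall v, dot g v = L v.
Proof.
move=> LP; have L_lin : linear (L : E -> R^o) by [].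
pose Llin := GRing.isLinear.Build _ _ _ _ (L : E -> R^o) L_lin.
pose L' : {linear E -> R^o} := HB.pack (L : E -> R^o) Llin.
exists (\sum_i L (e i) *: e i) => v.
rewrite dot_suml -[RHS]/(L' v) linear_basis.
by apply: eq_bigr => i _; rewrite dotZl mulrC.
Qed.

(** Coordinates are bounded by the norm, so the set is the continuous image of a closed bounded set
    of row vectors. *)
Lemma fin_bounded_closed_compact (A : set E) :
  bounded_set A -> closed A -> compact A.
Proof.
move=> [B [Breal Ble]] Acl.
pose g (z : 'rV[R]_p) : E := \sum_i z 0 i *: e i.
have g_cont : continuous g.
  move=> z; apply: (@cvg_fin_sum R E _ (nbhs z)) => i; apply: cvgZr_tmp.
  exact: coord_continuous.
have cE (z : 'rV[R]_p) i : dot (e i) (g z) = z 0 i.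
  rewrite /g dot_sumr (bigD1 i)//= dotZr basis.1 eqxx mulr1.
  rewrite big1 ?addr0// => j ji.
  by rewrite dotZr basis.1 eq_sym (negbTE ji) mulr0.
have -> : A = g @` (g @^-1` A).
  apply/seteqP; split=> [x Ax|x [z Az <-]//].
  have gx : g (\row_i dot (e i) x) = x.
    rewrite [RHS]basis_expansion; apply: eq_bigr => i _.
    by rewrite mxE.
  by exists (\row_i dot (e i) x) => //=; rewrite gx.
apply: continuous_compact; first exact: continuous_subspaceT.
apply: bounded_closed_compact; last exact: closed_comp.
exists (Num.max B 0); split; first by rewrite num_real.
move=> b Bb z /= Az.
have b0 : 0 < b by rewrite (le_lt_trans _ Bb)// le_max lexx orbT.
rewrite [leLHS]/Num.Def.normr /= mx_normrE; apply/bigmax_leP; split;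
  first exact: ltW.
case=> i j _ /=; rewrite ord1 -cE (le_trans (norm_coord _ _))//.
by apply: Ble Az; rewrite (le_lt_trans _ Bb)// le_max lexx.
Qed.

Lemma linear_subspaceZ (S : set E) a u : linear_subspace S -> S u -> S (a *: u).
Proof. by move=> [S0 SP] Su; rewrite -[_ *: _]addr0; exact: SP. Qed.

Lemma linear_subspace_sum (S : set E) (I : finType) (c : I -> R) (u : I -> E) :
  linear_subspace S -> (forall i, S (u i)) -> S (\sum_i c i *: u i).
Proof.
by move=> [S0 SP] Su; elim/big_ind: _ => // [x y Sx Sy|i _];
  [rewrite -[x]scale1r; exact: SP|exact: linear_subspaceZ].
Qed.

(* A matrix of maximal rank with rows in the subspace spans it, so that the
   subspace is the kernel of a linear map. *)
Lemma linear_subspace_closed (S : set E) : linear_subspace S -> closed S.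
Proof.
move=> Ssub; pose g (z : 'rV[R]_p) : E := \sum_i z 0 i *: e i.
pose c (x : E) : 'rV[R]_p := \row_i dot (e i) x.
have gc x : g (c x) = x.
  by rewrite [RHS]basis_expansion; apply: eq_bigr => i _; rewrite mxE.
have gP a u v : g (a *: u + v) = a *: g u + g v.
  rewrite /g scaler_sumr -big_split/=; apply: eq_bigr => i _.
  by rewrite !mxE scalerDl scalerA.
have g0 : g 0 = 0 by rewrite /g big1// => i _; rewrite mxE scale0r.
have g_mul m (D : 'M[R]_(m, p)) (z : 'rV_m) : (forall i, S (g (row i D))) ->
    S (g (z *m D)).
  move=> DS; rewrite mulmx_sum_row.
  have -> : g (\sum_i z 0 i *: row i D) = \sum_i z 0 i *: g (row i D).
    elim/big_rec2: _ => // i x y _ <-; exact: gP.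
  exact: linear_subspace_sum.
pose P n := `[< exists A : 'M[R]_p, \rank A = n /\ forall i, S (g (row i A)) >].
have [|n n_le|n /asboolP[A [rkA AS]] n_max] := @ex_maxnP P p.
- by exists 0%N; apply/asboolP; exists 0; split=> [|i];
    rewrite ?mxrank0// row0 g0; exact: Ssub.1.
- by move/asboolP: n_le => [A [<- _]]; exact: rank_leq_row.
have SE x : S x <-> c x *m cokermx A = 0.
  split=> [Sx|/eqP]; last first.
    rewrite -submxE => /submxP[z cz]; rewrite -(gc x) cz; exact: g_mul.
  apply/eqP; rewrite -submxE (submx_trans (addsmxSl _ A))//.
  rewrite -(mxrank_leqif_sup (addsmxSr (c x) A)).
  rewrite eqn_leq mxrankS ?addsmxSr//= rkA n_max//.
  apply/asboolP; exists (c x + A)%MS; split=> // i.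
  have /submxP[z ->] : (row i (c x + A)%MS <= col_mx (c x) A)%MS.
    by rewrite (submx_trans (row_sub _ _))// addsmxE.
  apply: g_mul => k; case: (split_ordP k) => l ->; last by rewrite rowKd.
  by rewrite rowKu row_id gc.
have -> : S = \bigcap_(j in setT) ((fun x => (c x *m cokermx A) 0 j) @^-1` [set
  0 : R]).
  apply/seteqP; split=> x.
    by move=> /SE cx j _; rewrite /= cx mxE.
  move=> h; apply/SE/matrixP => i j; rewrite ord1 (h j I) mxE //.
apply: closed_bigI => j _; apply: closed_comp; last exact: closed_eq.
move=> x _.
pose L := ((fun x => (c x *m cokermx A) 0 j) : E -> R^o).
have L_lin : linear L.
  move=> a u v; rewrite /L.
  have -> : c (a *: u + v) = a *: c u + c v.
    by apply/matrixP => i k; rewrite !mxE dotDr dotZr.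
  by rewrite mulmxDl -scalemxAl !mxE.
pose Llin := GRing.isLinear.Build _ _ _ _ L L_lin.
pose L' : {linear E -> R^o} := HB.pack L Llin.
exact: (linear_fin_continuous (L := L')).
Qed.

End Basis.
End InnerProductSpace.

Lemma convex_functionI (R : realType) (E : lmodType R) (g : E -> R) :
  (forall (t : R) (x y : E), 0 <= t <= 1 ->
    g (t *: x + (1 - t) *: y) <= t * g x + (1 - t) * g y) ->
  convex_function setT g.
Proof. by move=> gconv t x y _ _; apply: (gconv t%:inum x y); rewrite ge0 le1.
  Qed.

Lemma convex_functionE (R : realType) (E : lmodType R) (g : E -> R) :
  convex_function setT g -> forall (t : R) (x y : E), 0 <= t <= 1 ->
  g (t *: x + (1 - t) *: y) <= t * g x + (1 - t) * g y.
Proof.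
move=> gconv t x y /andP[t0 t1].
pose s : {i01 R} := Itv01 t0 t1.
by have := gconv s x y (in_setT _) (in_setT _).
Qed.

(** * Convex functions *)

Section HahnBanach.
Variables (R : realType) (Z : normedModType R) (g : Z -> R).
Hypothesis g_convex : convex_function setT g.

Definition dominated (G : set (Z * R^o)) :=
  linear_subspace G /\ forall u (a : R), G (u, a) -> a <= g u.

(* Subspaces of the product Z * R stand for the graphs of linear functionals
   defined on a subspace of Z. *)
Lemma hahn_banach_step (G : set (Z * R^o)) (e : Z) : dominated G ->
  exists (c : R) (G' : set (Z * R^o)), [/\ dominated G', G `<=` G' & G' (e, c)].
Proof.
move=> [[G0 GP] Gg].
(* The value at [e] must lie above these left slopes and below the right slopes
   [(g (u + t *: e) - a) / t]; the supremum of the left slopes will do. *)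
pose lower := [set x : R | exists u b s, [/\ G (u, b), 0 < s &
  x = (b - g (u - s *: e)) / s]].
have key u (a : R) v (b : R) s t : G (u, a) -> G (v, b) -> 0 < s -> 0 < t ->
    (b - g (v - s *: e)) / s <= (g (u + t *: e) - a) / t.
  move=> Gu Gv s0 t0.
  have st0 : 0 < s + t by exact: addr_gt0.
  (* This weight cancels the components along [e], so that the combination lies over the domain of
     [G] and domination applies. *)
  pose k := t / (s + t).
  have k1 : 1 - k = s / (s + t) by rewrite /k; field; rewrite gt_eqF.
  have k01 : 0 <= k <= 1.
    rewrite /k ler_pdivrMr// mul1r lerDr (ltW s0) andbT.
    by apply: divr_ge0; exact: ltW.
  have Gk : G (k *: v + (1 - k) *: u, k * b + (1 - k) * a).
    apply: (GP k (v, b) ((1 - k) *: (u, a : R^o))) => //.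
    by rewrite -[_ *: _]addr0; exact: GP.
  have := le_trans (Gg _ _ Gk) _; move/(_ (k * g (v - s *: e) + (1 - k) * g (u
    + t *: e))).
  have -> : k *: v + (1 - k) *: u = k *: (v - s *: e) + (1 - k) *: (u + t *: e).
    rewrite !scalerDr scalerN !scalerA addrACA.
    have -> : k * s = (1 - k) * t by rewrite k1 /k; field; rewrite gt_eqF.
    by rewrite addrC addNr add0r.
  move=> /(_ (convex_functionE g_convex _ _ k01)).
  rewrite k1 /k => H.
  rewrite ler_pdivrMr// mulrAC ler_pdivlMr//.
  rewrite -(ler_pM2l (x := (s + t)^-1)) ?invr_gt0//.
  by move: H; lra.
have lower0 : lower !=set0.
  by exists ((0 - g (0 - 1 *: e)) / 1); exists 0, 0, 1; split.
have lower_ub : has_ubound lower.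
  exists ((g (0 + 1 *: e) - 0) / 1) => _ [u [b [s [Gu s0 ->]]]].
  exact: key.
pose c := sup lower.
exists c, [set w | exists ua t, G ua /\ w = ua + t *: (e, c : R^o)]; split.
- split; first split.
  + by exists 0, 0; split=> //; rewrite scale0r addr0.
  + move=> a _ _ [u [t [Gu ->]]] [v [s [Gv ->]]].
    exists (a *: u + v), (a * t + s); split; first exact: GP.
    by rewrite scalerDr scalerA scalerDl addrACA.
  + move=> _ _ [[u a] [t [Gu [-> ->]]]] /=.
    have [t0|t0|->] := ltgtP t 0; last first.
    * by rewrite !scale0r !addr0; exact: Gg.
    * rewrite -lerBrDl /GRing.scale/= mulrC -ler_pdivlMr//.
      by apply: ge_sup => // _ [v [b [s [Gv s0 ->]]]]; exact: key.
    * have : (a - g (u - (- t) *: e)) / (- t) <= c.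
        by apply: ub_le_sup => //; exists u, a, (- t); rewrite oppr_gt0.
      rewrite ler_pdivrMr ?oppr_gt0// scaleNr opprK mulrN mulrC /GRing.scale/=.
      by lra.
- by move=> u Gu; exists u, 0; split=> //; rewrite scale0r addr0.
- by exists 0, 1; split=> //; rewrite scale1r add0r.
Qed.

Lemma hahn_banach_seq (I : finType) (s : seq I) (e : I -> Z)
  (G : set (Z * R^o)) : dominated G ->
  exists (c : I -> R) (G' : set (Z * R^o)),
    [/\ dominated G', G `<=` G' & {in s, forall i, G' (e i, c i)}].
Proof.
move=> Gdom; elim: s => [|i s [c [G' [G'dom GG' G's]]]].
  by exists (fun=> 0), G; split.
have [b [G'' [G''dom G'G'' G''e]]] := hahn_banach_step (e i) G'dom.
exists (fun j => if j == i then b else c j), G''; split=> //.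
  exact: subset_trans G'G''.
move=> j; rewrite inE; case: eqVneq => [-> _|_ /= js]//.
exact/G'G''/G's.
Qed.

Lemma hahn_banach (dot : {dot Z for idfun}) (r : nat) (d : 'I_r -> Z)
  (G : set (Z * R^o)) : orthonormal_basis dot d -> g 0 = 0 -> dominated G ->
  exists xi, (forall u, dot xi u <= g u) /\
    (forall u (a : R), G (u, a) -> a = dot xi u).
Proof.
move=> basis g0 Gdom.
have [c [G' [[[G'0 G'P] G'g] GG' G'd]]] :=
  hahn_banach_seq (enum 'I_r) d Gdom.
exists (\sum_i c i *: d i).
have G'dot u : G' (u, dot (\sum_i c i *: d i) u).
  have -> : (u, dot (\sum_i c i *: d i) u : R^o) =
      \sum_i dot (d i) u *: (d i, c i : R^o).
    rewrite {1}(basis_expansion basis u) dot_suml.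
    rewrite (eq_bigr (fun i => dot (d i) u * c i)); last first.
      by move=> i _; rewrite dotZl mulrC.
    by elim/big_rec3: _ => // i x y w _ <-.
  by apply: linear_subspace_sum => // i; exact: G'd (mem_enum _ _).
split=> [u|u a /GG' G'u]; first exact: G'g.
(* [G'] is single-valued: the difference of two values lies over 0, where [g] vanishes. *)
have diff b b' : G' (u, b) -> G' (u, b') -> b <= b'.
  move=> Gb Gb'; rewrite -subr_le0 -g0; apply: G'g.
  have -> : (0, b - b' : R^o) = -1 *: (u, b' : R^o) + (u, b : R^o) :> Z * R^o.
    by rewrite scaleN1r [RHS]addrC -[RHS]/(u - u, b - b') subrr.
  exact: G'P.
by apply/eqP; rewrite eq_le !diff.
Qed.

End HahnBanach.

(** * Local bounds for finite convex functions and their subgradients *)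

Section ConvexRegularity.
Variables (R : realType) (Z : normedModType R) (dot : {dot Z for idfun}).
Hypothesis normZ : norm_from dot.
Variables (r : nat) (d : 'I_r -> Z).
Hypothesis basis : orthonormal_basis dot d.
Variable g : Z -> R.
Hypothesis g_convex : convex_function setT g.

Lemma convex_line_upper (z h : Z) (s : R) : `|s| <= 1 ->
  g (z + s *: h) - g z <= `|s| * (`|g (z + h) - g z| + `|g (z - h) - g z|).
Proof.
have pos (u : Z) (t : R) : 0 <= t <= 1 ->
    g (z + t *: u) - g z <= t * `|g (z + u) - g z|.
  move=> t01; have := convex_functionE g_convex (z + u) z t01.
  have -> : t *: (z + u) + (1 - t) *: z = z + t *: u.
    by rewrite scalerDr scalerBl scale1r addrC addrA subrK.
  have := ler_norm (g (z + u) - g z) => H1.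
  have : t * (g (z + u) - g z) <= t * `|g (z + u) - g z|.
    by apply: ler_wpM2l => //; case/andP: t01.
  by lra.
have [s0 s1|s0 s1] := ger0P s.
  apply: (@le_trans _ _ (s * `|g (z + h) - g z|)); first by apply: pos;
    rewrite s0.
  by rewrite ler_wpM2l// lerDl.
apply: (@le_trans _ _ (- s * `|g (z - h) - g z|)).
  have -> : z + s *: h = z + (- s) *: (- h) by rewrite scalerN scaleNr opprK.
  by apply: pos; rewrite oppr_ge0 ltW.
by rewrite ler_wpM2l ?oppr_ge0 ?(ltW s0)// lerDr.
Qed.

(* Coordinates are split off one at a time as midpoints, whence the factors 2
   on the coefficients in the proof. *)
Lemma convex_upper_seq (z : Z) (s : seq 'I_r) : exists2 C : R, 0 <= C &
  exists2 delta : R, 0 < delta & forall a : 'I_r -> R,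
  (forall i, `|a i| <= delta) ->
  g (z + \sum_(i <- s) a i *: d i) - g z <= C * \sum_(i <- s) `|a i|.
Proof.
elim: s => [|i s [C C0 [delta delta0 IH]]].
  exists 0 => //; exists 1 => // a _.
  by rewrite !big_nil addr0 subrr mulr0.
pose K := `|g (z + d i) - g z| + `|g (z - d i) - g z|.
exists (C + K); first by rewrite addr_ge0// addr_ge0.
exists (Num.min delta 1 / 2); first by rewrite divr_gt0// lt_min delta0 ltr01.
move=> a a_le; rewrite !big_cons.
have a_le1 j : `|2 * a j| <= Num.min delta 1.
  by rewrite normrM ger0_norm// mulrC -ler_pdivlMr.
have a_led j : `|2 * a j| <= delta by rewrite (le_trans (a_le1 _))// ge_min
  lexx.
have a_le11 j : `|2 * a j| <= 1.
  by rewrite (le_trans (a_le1 _))// ge_min lexx orbT.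
have half01 : 0 <= (2^-1 : R) <= 1 by lra.
have := convex_functionE g_convex (z + (2 * a i) *: d i)
  (z + \sum_(j <- s) (2 * a j) *: d j) half01.
have -> : 1 - 2^-1 = 2^-1 :> R by lra.
have -> : 2^-1 *: (z + (2 * a i) *: d i) +
    2^-1 *: (z + \sum_(j <- s) (2 * a j) *: d j) =
    z + (a i *: d i + \sum_(j <- s) a j *: d j).
  rewrite !scalerDr scalerA mulKf ?pnatr_eq0// addrACA -scalerDl.
  have -> : 2^-1 + 2^-1 = 1 :> R by lra.
  rewrite scale1r; congr (_ + (_ + _)).
  rewrite scaler_sumr; apply: eq_bigr => j _.
  by rewrite scalerA mulKf ?pnatr_eq0.
have := IH _ a_led; have := convex_line_upper z (d i) (a_le11 i).
rewrite -/K.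
have -> : \sum_(j <- s) `|2 * a j| = 2 * \sum_(j <- s) `|a j|.
  by rewrite mulr_sumr; apply: eq_bigr => j _; rewrite normrM ger0_norm.
rewrite normrM (ger0_norm (ler0n _ 2)).
set S := \sum_(j <- s) `|a j|.
have S0 : 0 <= S by apply: sumr_ge0.
have K0 : 0 <= K by apply: addr_ge0.
have := mulr_ge0 K0 S0; have := mulr_ge0 C0 (normr_ge0 (a i)).
by lra.
Qed.

(** A Lipschitz estimate with one endpoint fixed at [z]; continuity and the local bound on
    subgradients both follow from it. *)
Lemma convex_locally_bounded (z : Z) : exists2 C : R, 0 <= C &
  exists2 delta : R, 0 < delta &
    forall h, `|h| <= delta -> `|g (z + h) - g z| <= C * `|h|.
Proof.
have [C C0 [delta delta0 H]] := convex_upper_seq z (index_enum 'I_r).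
exists (C * r%:R); first by rewrite mulr_ge0.
exists delta => // h hd.
have upper (u : Z) : `|u| <= delta -> g (z + u) - g z <= C * r%:R * `|u|.
  move=> ud; rewrite {1}(basis_expansion basis u).
  apply: le_trans (H _ _) _.
    by move=> i; exact: le_trans (norm_coord normZ basis _ _) ud.
  rewrite -mulrA ler_wpM2l//.
  apply: (@le_trans _ _ (\sum_(i < r) `|u|)).
    by apply: ler_sum => i _; exact: norm_coord.
  by rewrite sumr_const card_ord mulr_natl.
rewrite ler_norml upper// andbT.
have half01 : 0 <= (2^-1 : R) <= 1 by lra.
(* The lower bound is the upper bound at [- h], since [z] is the midpoint of [z + h] and [z - h]. *)
have := convex_functionE g_convex (z + h) (z - h) half01.
have -> : 1 - 2^-1 = 2^-1 :> R by lra.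
have -> : 2^-1 *: (z + h) + 2^-1 *: (z - h) = z.
  rewrite -scalerDr addrACA subrr addr0 scalerDr -scalerDl.
  by have -> : 2^-1 + 2^-1 = 1 :> R; [lra|rewrite scale1r].
have := upper (- h); rewrite normrN => /(_ hd).
by lra.
Qed.

Lemma convex_continuous : continuous (g : Z -> R^o).
Proof.
move=> z; have [C C0 [delta delta0 H]] := convex_locally_bounded z.
apply/cvgrPdist_le => eps eps0.
near=> y; have -> : y = z + (y - z) by rewrite addrC subrK.
rewrite distrC; apply: le_trans (H _ _) _.
  by rewrite distrC; near: y; apply: cvgr_dist_le; first exact: cvg_id.
rewrite (@le_trans _ _ ((C + 1) * `|y - z|))//.
  by rewrite ler_wpM2r// lerDl.
rewrite -ler_pdivlMl ?ltr_wpDl// distrC.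
near: y; apply: cvgr_dist_le; first exact: cvg_id.
by rewrite mulr_gt0// invr_gt0 ltr_wpDl.
Unshelve. all: by end_near. Qed.

Lemma convex_subgradient_bounded (z : Z) : exists2 C : R, 0 <= C &
  \forall y \near z, forall xi,
    (forall u, dot xi u <= g (y + u) - g y) -> `|xi| <= C.
Proof.
have [C C0 [delta delta0 H]] := convex_locally_bounded z.
exists (4 * C); first by rewrite mulr_ge0.
near=> y => xi xiP.
have [->|xi0] := eqVneq xi 0; first by rewrite normr0 mulr_ge0.
have nxi : 0 < `|xi| by rewrite normr_gt0.
(* The subgradient inequality is tested along [xi] with a step of length [delta / 2], short enough
   to keep [y + u] within [delta] of [z]; the increment of [g] is then at most [2 * C * delta]. *)
pose u := (delta / 2 / `|xi|) *: xi.
have yz : `|y - z| <= delta / 2.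
  rewrite distrC; near: y; apply: cvgr_dist_le; first exact: cvg_id.
  by rewrite divr_gt0.
have nu : `|u| = delta / 2.
  rewrite normrZ ger0_norm ?divr_ge0 ?ltW ?divr_gt0//.
  by rewrite divfK// gt_eqF.
have yuz : `|y - z + u| <= delta.
  rewrite (le_trans (ler_normD _ _))// nu.
  by move: yz; lra.
have yzd : `|y - z| <= delta by move: yz; lra.
have := H _ yuz; have := H _ yzd.
have zy : z + (y - z) = y by rewrite addrC subrK.
rewrite (addrA z (y - z)) zy => h1 h2.
have b1 : `|g y - g z| <= C * delta by rewrite (le_trans h1)// ler_wpM2l.
have b2 : `|g (y + u) - g z| <= C * delta by rewrite (le_trans h2)// ler_wpM2l.
have := xiP u; rewrite /u dotZr (dot_norm normZ).
have -> : delta / 2 / `|xi| * `|xi| ^+ 2 = delta / 2 * `|xi|.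
  by field; rewrite gt_eqF.
rewrite -/u => b3.
rewrite -(ler_pM2l (divr_gt0 delta0 (ltr0n R 2))).
move: b1 b2 b3; rewrite !ler_norml => /andP[? ?] /andP[? ?] ?.
by lra.
Unshelve. all: by end_near. Qed.

End ConvexRegularity.

(** * Submanifolds and their tangent spaces *)

(** [L] is a bare function, so that expansions can be added and composed without building a
    continuous linear map each time. *)
Definition first_order (R : numFieldType) (V W : normedModType R) (f : V -> W)
    (x : V) (L : V -> W) :=
  forall eps : R, 0 < eps ->
    \forall y \near x, `|f y - f x - L (y - x)| <= eps * `|y - x|.

Lemma diff_first_order (R : numFieldType) (V W : normedModType R) (f : V -> W)
  (x : V) : differentiable f x -> first_order f x ('d f x).
Proof.
move=> /diff_locally /eqaddoP fo eps eps0; rewrite (near_shift 0)/= subr0.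
have := fo eps eps0; apply: filterS => h; rewrite /= addrK.
by rewrite -[(_ - _) h]/(f (h + x) - (f x + 'd f x h)) opprD addrA.
Qed.

Lemma first_order_diff (R : numFieldType) (V W : normedModType R) (f : V -> W)
  (x : V) (L : {linear V -> W}) : continuous L -> first_order f x L ->
  differentiable f x /\ 'd f x = L :> (V -> W).
Proof.
move=> Lcont fo.
have fE : f \o shift x = cst (f x) + L +o_ 0 id.
  apply/eqaddoP => eps eps0; have := fo eps eps0.
  rewrite (near_shift 0)/= subr0; apply: filterS => h; rewrite /= addrK.
  by rewrite -[(_ - (_ + _)) h]/(f (h + x) - (f x + L h)) opprD addrA.
have dfE := diff_unique Lcont fE.
by split=> //; apply/diff_locallyP; rewrite dfE.
Qed.

Lemma near_diff (R : numFieldType) (V W : normedModType R) (f g : V -> W)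
  (x : V) : (\forall y \near x, f y = g y) -> differentiable f x ->
  differentiable g x /\ 'd g x = 'd f x :> (V -> W).
Proof.
move=> fg df; apply: first_order_diff; first exact: diff_continuous.
move=> eps eps0; have fo := diff_first_order df eps0.
near=> y; have fgy : f y = g y by near: y.
by rewrite -fgy -(nbhs_singleton fg); near: y.
Unshelve. all: by end_near. Qed.

Lemma Ck_ext (R : realType) (V W : normedModType R) k (U : set V) (f g : V ->
  W) :
  open U -> (forall y, U y -> f y = g y) -> Ck k U f -> Ck k U g.
Proof.
move=> Uo; elim: k f g => [|k IH] f g fg /=.
  move=> fc x Ux; have := fc x Ux; rewrite /prop_for /continuous_at -(fg x Ux).
  apply: cvg_trans; apply: near_eq_cvg.
  by apply: filterS (open_nbhs_nbhs (conj Uo Ux)) => y /fg.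
have nfg x : U x -> \forall y \near x, f y = g y.
  by move=> Ux; apply: filterS (open_nbhs_nbhs (conj Uo Ux)) => y /fg.
move=> [df Ckdf]; split=> [x Ux|v]; first by have [] :=
  near_diff (nfg _ Ux) (df _ Ux).
apply: IH (Ckdf v) => x Ux.
have [_ dE] := near_diff (nfg _ Ux) (df _ Ux).
exact: (congr1 (fun L : V -> W => L v) (esym dE)).
Qed.

Lemma is_diff_affine (R : realType) (V : normedModType R) (z s : V) (t : R) :
  is_diff (t : R^o) (fun t : R^o => z + t *: s) (fun t : R^o => t *: s).
Proof.
by apply: is_diff_eq; rewrite add0r.
Qed.

(** An affine inner map suffices for the curves [psi (phi y + t *: s)], and it keeps the induction
    closed: the derivative along [h] is ['d f] in the fixed direction [h *: s], composed with the
    same line. *)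
Lemma Ck_comp_line (R : realType) (V W : normedModType R) k (U : set V)
  (f : V -> W) (z s : V) (D : set R^o) : open D ->
  (forall t, D t -> U (z + t *: s)) -> Ck k U f ->
  Ck k D (fun t => f (z + t *: s)).
Proof.
move=> Do DU; elim: k f => [|k IH] f /=.
  move=> fc t Dt.
  have lc := differentiable_continuous (ex_diff (is_diff_def :=
    is_diff_affine z s t)).
  exact: (continuous_comp lc (fc _ (DU _ Dt))).
move=> [df Ckdf]; have dl t := is_diff_affine z s t.
have dfl t : D t -> differentiable (f \o (fun t : R^o => z + t *: s)) t.
  by move=> Dt; apply: differentiable_comp; last exact/df/DU.
split=> [t Dt|h]; first exact: dfl.
apply: (@Ck_ext R R^o W _ _ _ _ Do _ (IH _ (Ckdf (h *: s)))) => t Dt.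
rewrite -[fun t => _]/(f \o (fun t : R^o => z + t *: s)).
have dc := diff_comp (ex_diff (is_diff_def := dl t)) (df _ (DU _ Dt)).
by rewrite dc /= (diff_val (is_diff_def := dl t)).
Qed.

Section Charts.
Variables (R : realType) (X : normedModType R) (dot : {dot X for idfun}).
Hypothesis normX : norm_from dot.
Variables (p : nat) (e : 'I_p -> X).
Hypothesis basis : orthonormal_basis dot e.
Variables (M S U V : set X) (phi psi : X -> X).
Hypothesis Ssub : linear_subspace S.
Hypothesis chart : slice_chart M S U V phi psi.

Let Uo : open U. Proof. by have [[]] := chart. Qed.
Let Vo : open V. Proof. by have [[]] := chart. Qed.

Lemma chart_diff y : U y -> differentiable phi y.
Proof. by have [_ [[+ _] _] _ _ _] := chart; apply. Qed.

Lemma chart_inv_diff z : V z -> differentiable psi z.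
Proof. by have [_ [_ [+ _]] _ _ _] := chart; apply. Qed.

Lemma chart_diffK y d : U y -> 'd psi (phi y) ('d phi y d) = d.
Proof.
move=> Uy; have [_ _ phiV _ _] := chart.
have dc := diff_comp (chart_diff Uy) (chart_inv_diff (phiV _ Uy).1).
rewrite -[LHS]/(('d psi (phi y) \o 'd phi y) d) -dc.
have nid : \forall z \near y, id z = (psi \o phi) z.
  by apply: filterS (open_nbhs_nbhs (conj Uo Uy)) => z /phiV[].
have [_ ->] := near_diff nid (ex_diff (is_diff_def := is_diff_id y)).
by rewrite diff_val.
Qed.

Lemma chart_diffVK y d : U y -> 'd phi y ('d psi (phi y) d) = d.
Proof.
move=> Uy; have [_ _ phiV psiU _] := chart.
have [Vy psiK] := phiV _ Uy.
have dphi : differentiable phi (psi (phi y)) by rewrite psiK; exact: chart_diff.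
have dc := diff_comp (chart_inv_diff Vy) dphi.
rewrite psiK in dc.
rewrite -[LHS]/(('d phi y \o 'd psi (phi y)) d) -dc.
have nid : \forall z \near phi y, id z = (phi \o psi) z.
  by apply: filterS (open_nbhs_nbhs (conj Vo Vy)) => z /psiU[].
have [_ ->] := near_diff nid (ex_diff (is_diff_def := is_diff_id (phi y))).
by rewrite diff_val.
Qed.

(** Turns the tangent space, defined by velocities, into a linear condition; its linearity and the
    equations of the tangent bundle come from here. *)
Lemma tangent_chart y d : U y -> M y -> tangent_space M y d <-> S ('d phi y d).
Proof.
move=> Uy My; have [_ [_ Ckpsi] phiV psiU MS] := chart; split.
  move=> [eps [c [eps0 [dc _] cM c0 cd]]].
  have dc0 : differentiable c (0 : R^o) by apply: dc; rewrite /= normr0.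
  have dphi : differentiable phi (c 0) by rewrite c0; exact: chart_diff.
  have -> : 'd phi y d = 'D_(1 : R^o) (phi \o c) 0.
    rewrite deriveE; last exact: differentiable_comp.
    by have dcomp := diff_comp dc0 dphi; rewrite dcomp /= c0 cd.
  have Dc : derivable (phi \o c) (0 : R^o) (1 : R^o).
    exact/diff_derivable/differentiable_comp.
  (* The difference quotients of [phi \o c] lie in the closed subspace [S], hence so does their
     limit. *)
  apply: closed_cvg (linear_subspace_closed normX basis Ssub) _ _ Dc.
  have cU : \forall t \near (0 : R^o), U (c t).
    apply: (differentiable_continuous dc0); rewrite c0.
    exact: open_nbhs_nbhs.
  have ceps : \forall t \near (0 : R^o), `|t| < eps.
    by apply: nbhs0_lt.
  near=> t.
  have Sphi s : `|s| < eps -> U (c s) -> S (phi (c s)).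
    by move=> seps Ucs; apply/MS => //; exact: cM.
  apply: linear_subspaceZ => //=; rewrite addr0 [_%:A]mulr1.
  rewrite addrC -scaleN1r; apply: Ssub.2.
    by apply: Sphi; rewrite ?normr0// c0.
  by apply: Sphi; near: t; apply: nbhs_dnbhs.
move=> Sd.
have Vy := (phiV _ Uy).1.
(* Conversely, the curve is the image under [psi] of the line through [phi y] with direction [s],
   for small times. *)
pose s := 'd phi y d.
have dl t := is_diff_affine (phi y) s t.
have [eps /= eps0 lV] : exists2 eps : R, 0 < eps &
    forall t, `|t| < eps -> V (phi y + t *: s).
  have : \forall t \near (0 : R^o), V (phi y + t *: s).
    apply: (differentiable_continuous (ex_diff (is_diff_def := dl 0))).
    by rewrite scale0r addr0; exact: open_nbhs_nbhs.
  move=> [eps /= eps0 H]; exists eps => // t teps; apply: H.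
  by rewrite /ball_/= sub0r normrN.
exists eps, (fun t => psi (phi y + t *: s)); split=> //.
- apply: Ck_comp_line Ckpsi => //.
  rewrite (_ : [set t : R^o | `|t| < eps] = ball (0 : R^o) eps); last first.
    by apply/seteqP; split=> t; rewrite -ball_normE /ball_/= sub0r normrN.
  exact: ball_open.
- move=> t /lV Vt; have [Upsi phiK] := psiU _ Vt.
  apply/MS => //; rewrite phiK addrC; apply: Ssub.2 => //.
  by apply/MS.
- by rewrite scale0r addr0; have [] := phiV _ Uy.
- have Vy0 : V (phi y + 0 *: s) by rewrite scale0r addr0.
  rewrite -[fun t => _]/(psi \o (fun t : R^o => phi y + t *: s)).
  have dc := diff_comp (ex_diff (is_diff_def := dl 0)) (chart_inv_diff Vy0).
  rewrite dc /= (diff_val (is_diff_def := dl 0)) scale1r scale0r addr0.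
  by rewrite chart_diffK.
Unshelve. all: by end_near. Qed.

End Charts.

(** * Rates from descent and the KL inequality *)

Lemma young_powR (R : realType) (x y t : R) : 0 <= x -> 0 <= y -> 0 < t < 1 ->
  x `^ t * y `^ (1 - t) <= t * x + (1 - t) * y.
Proof.
move=> x0 y0 /andP[t0 t1].
have t'0 : 0 < 1 - t by rewrite subr_gt0.
have := @conjugate_powR R (x `^ t) (y `^ (1 - t)) t^-1 (1 - t)^-1
  (powR_ge0 _ _) (powR_ge0 _ _).
rewrite !invr_gt0 !invrK -!powRrM !divff ?gt_eqF// !powRr1//.
by rewrite [x * _]mulrC [y * _]mulrC; apply => //; rewrite addrC subrK.
Qed.

Section SequenceRates.
Variables (R : realType) (a b : nat -> R) (q g C : R) (K : nat).
Hypothesis q_range : 2^-1 <= q < 1.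
Hypothesis g_gt0 : 0 < g.
Hypothesis C_gt0 : 0 < C.
Hypothesis a_gt0 : forall k, 0 < a k.
Hypothesis b_ge0 : forall k, 0 <= b k.
Hypothesis descent : forall k, g * b k ^+ 2 <= a k - a k.+1.
Hypothesis a_le1 : forall k, (K <= k)%N -> a k <= 1.
Hypothesis KL : forall k, (K <= k)%N -> a k.+1 `^ q <= C * b k.

Let q_gt0 : 0 < q. Proof. by move: q_range; lra. Qed.
Let q_lt1 : 0 < 1 - q. Proof. by move: q_range; lra. Qed.

Let phi k := a k `^ (1 - q).
Let D := C / ((1 - q) * g).

Let D_ge0 : 0 <= D. Proof. by rewrite divr_ge0 ?mulr_ge0 ?ltW. Qed.

Lemma a_nonincreasing k : a k.+1 <= a k.
Proof.
have := descent k; have := mulr_ge0 (ltW g_gt0) (sqr_ge0 (b k)).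
by lra.
Qed.

Lemma phi_nonincreasing k : phi k.+1 <= phi k.
Proof.
apply: ge0_ler_powR; rewrite ?nnegrE ?(ltW q_lt1) ?(ltW (a_gt0 _))//.
exact: a_nonincreasing.
Qed.

(* Concavity of s |-> s `^ (1 - q) turns the KL inequality into a recursion
   bounding b k.+1 by half of b k plus a telescoping term. *)
Lemma lyapunov k : (K <= k)%N ->
  b k.+1 <= (b k + D * phi k.+1) - (b k.+1 + D * phi k.+2).
Proof.
move=> Kk; have := descent k.+1; set s := a k.+1; set t := a k.+2.
have s0 : 0 < s := a_gt0 _; have t0 : 0 < t := a_gt0 _.
have q01 : 0 < q < 1 by rewrite q_gt0; move: q_range; lra.
have := young_powR (ltW s0) (ltW t0) q01.
have sE : s = s `^ q * phi k.+1.
  rewrite /phi -/s -powRD; last by rewrite addrC subrK oner_eq0.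
  by rewrite addrC subrK powRr1// ltW.
rewrite -/(phi k.+2) => young desc.
have phi_le := phi_nonincreasing k.+1.
have h1 : (1 - q) * (s - t) <= s `^ q * (phi k.+1 - phi k.+2).
  by rewrite [leRHS]mulrBr -sE; move: young; lra.
have h2 : s `^ q * (phi k.+1 - phi k.+2) <= C * b k * (phi k.+1 - phi k.+2).
  by rewrite ler_wpM2r ?subr_ge0//; exact: KL.
set w := phi k.+1 - phi k.+2 in h1 h2 *.
have w0 : 0 <= w by rewrite subr_ge0.
have h3 : b k.+1 ^+ 2 <= b k * (D * w).
  have h4 : (1 - q) * (g * b k.+1 ^+ 2) <= C * b k * w.
    apply: le_trans h2; apply: le_trans h1.
    by apply: ler_wpM2l => //; exact: ltW.
  rewrite -(ler_pM2l (mulr_gt0 q_lt1 g_gt0)) -mulrA (le_trans h4)//.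
  rewrite /D le_eqVlt; apply/orP; left; apply/eqP; field.
  by rewrite !gt_eqF.
have Dw0 : 0 <= D * w by exact: mulr_ge0.
have h5 : 2 * b k.+1 <= b k + D * w.
  rewrite -(@ler_pXn2r _ 2)// ?nnegrE ?mulr_ge0 ?addr_ge0//.
  rewrite exprMn; have := sqr_ge0 (b k - D * w); rewrite sqrrB sqrrD.
  by move: h3; lra.
have -> : b k + D * phi k.+1 - (b k.+1 + D * phi k.+2) = b k + D * w - b k.+1.
  by rewrite /w; ring.
by move: h5; lra.
Qed.

(** Here [2^-1 <= q] matters: with [a k <= 1] and [2 * (1 - q) <= 1], the gap [a k] is at most the
    square of [phi k]. *)
Lemma b_le_phi k : (K <= k)%N -> b k <= (Num.sqrt g)^-1 * phi k.
Proof.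
move=> Kk; have sg : 0 < Num.sqrt g by rewrite sqrtr_gt0.
rewrite -(ler_pM2l sg) mulVKf ?gt_eqF//.
rewrite -(@ler_pXn2r _ 2)// ?nnegrE ?mulr_ge0 ?powR_ge0// ?(ltW sg)//.
rewrite exprMn sqr_sqrtr ?(ltW g_gt0)//.
rewrite -(powR_mulrn 2 (powR_ge0 (a k) (1 - q))) -powRrM.
apply: (@le_trans _ _ (a k)).
  by have := descent k; have := a_gt0 k.+1; lra.
rewrite -{1}(powRr1 (ltW (a_gt0 k))); apply: ger_powR.
  by rewrite a_gt0 a_le1.
by move: q_range; lra.
Qed.

Lemma iterates_dist (E : normedModType R) (u : nat -> E) (L : R) :
  0 <= L -> (forall k, (K <= k)%N -> `|u k.+1 - u k| <= L * b k) ->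
  forall m n, (K <= m <= n)%N ->
    `|u n - u m| <= L * (2 * (Num.sqrt g)^-1 + D) * phi m.
Proof.
move=> L0 ub m n /andP[Km mn].
(* [Vm] telescopes by [lyapunov], which bounds [b] only from index [m.+1] on. The step from [m] to
   [m.+1] is added separately, whence two copies of [b m] and the factor 2 in the constant. *)
pose Vm k := b k + D * phi k.+1.
have Vm0 k : 0 <= Vm k by rewrite addr_ge0// mulr_ge0// powR_ge0.
have tel j : `|u (m.+1 + j)%N - u m.+1| <= L * (Vm m - Vm (m + j)%N).
  elim: j => [|j IH]; first by rewrite !addn0 !subrr normr0 mulr0.
  rewrite !addnS; apply: (@le_trans _ _ (`|u (m.+1 + j).+1 - u (m.+1 + j)%N| +
      `|u (m.+1 + j)%N - u m.+1|)).
    by rewrite (le_trans _ (ler_normD _ _))// addrA subrK.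
  apply: (@le_trans _ _ (L * b (m.+1 + j)%N + L * (Vm m - Vm (m + j)%N))).
    apply: lerD => //; apply: ub.
    by rewrite (leq_trans Km)// addSn -addnS leq_addr.
  rewrite -mulrDr ler_wpM2l//.
  have := @lyapunov (m + j)%N (leq_trans Km (leq_addr _ _)).
  by rewrite addSn /Vm; lra.
have bphi := b_le_phi Km; have phile := phi_nonincreasing m.
have sg : 0 <= (Num.sqrt g)^-1 by rewrite invr_ge0 sqrtr_ge0.
have Dphi : D * phi m.+1 <= D * phi m by apply: ler_wpM2l.
have [->|nm] := eqVneq n m.
  by rewrite subrr normr0 !mulr_ge0 ?powR_ge0// addr_ge0// mulr_ge0.
have {}mn : (m < n)%N by rewrite ltn_neqAle eq_sym nm.
apply: (@le_trans _ _ (L * Vm m + L * b m)); last first.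
  rewrite -mulrDr -mulrA ler_wpM2l// /Vm.
  by move: bphi Dphi; lra.
apply: (@le_trans _ _ (`|u n - u m.+1| + `|u m.+1 - u m|)).
  by rewrite (le_trans _ (ler_normD _ _))// addrA subrK.
apply: lerD; last exact: ub.
rewrite -(subnKC mn) (le_trans (tel _))// ler_wpM2l//.
by have := Vm0 (m + (n - m.+1))%N; lra.
Qed.

(** For [q = 2^-1] the squared KL inequality and the descent combine to
    [a k.+1 <= B * (a k - a k.+1)] with [B = C ^+ 2 / g]. *)
Lemma linear_rate : q = 2^-1 -> exists2 rho : R, 0 < rho < 1 &
  forall k, (K <= k)%N -> a k.+1 <= rho * a k.
Proof.
move=> qE; pose B := C ^+ 2 / g.
have B0 : 0 < B by rewrite divr_gt0// exprn_gt0.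
have B1 : 0 < B + 1 by rewrite addr_gt0.
exists (B / (B + 1)).
  by rewrite divr_gt0//= ltr_pdivrMr// mul1r ltrDl.
move=> k Kk; have := KL Kk; rewrite qE => KLk.
have h1 : a k.+1 <= C ^+ 2 * b k ^+ 2.
  have -> : a k.+1 = (a k.+1 `^ 2^-1) ^+ 2.
    by rewrite powR12_sqrt ?(ltW (a_gt0 _))// sqr_sqrtr// ltW.
  by rewrite -exprMn ler_pXn2r// ?nnegrE ?mulr_ge0 ?powR_ge0// ltW.
have h2 : C ^+ 2 * b k ^+ 2 <= B * (a k - a k.+1).
  rewrite /B -mulrA ler_wpM2l ?sqr_ge0//.
  by rewrite -(ler_pM2l g_gt0) mulVKf ?gt_eqF.
rewrite mulrAC ler_pdivlMr//.
by move: (le_trans h1 h2); lra.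
Qed.

Lemma sublinear_rate : 2^-1 < q -> exists2 c : R, 0 < c &
  forall k, (2 * K.+1 <= k)%N -> a k <= c * k%:R `^ (1 / (1 - 2 * q)).
Proof.
move=> q2; pose nu := 2 * q - 1.
have nu0 : 0 < nu by rewrite /nu; lra.
have nu1 : 0 < nu < 1 by rewrite nu0 /nu; move: q_range; lra.
pose B := C ^+ 2 / g; have B0 : 0 < B by rewrite divr_gt0// exprn_gt0.
pose c := nu / (B + 1).
have B1 : 0 < B + 1 by rewrite addr_gt0.
have c0 : 0 < c by rewrite divr_gt0.
have step k : (K <= k)%N -> a k `^ (- nu) + c <= a k.+1 `^ (- nu).
  move=> Kk; set s := a k; set t := a k.+1.
  have s0 : 0 < s := a_gt0 _; have t0 : 0 < t := a_gt0 _.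
  have ts : t <= s := a_nonincreasing k.
  have tnu0 : 0 < t `^ nu by exact: powR_gt0.
  have tnu1 : t `^ nu <= 1.
    have t1 : t <= 1 := le_trans ts (a_le1 Kk).
    rewrite [leRHS](_ : 1 = 1 `^ nu); last by rewrite powR1.
    by apply: ge0_ler_powR; rewrite ?nnegrE ?(ltW nu0) ?(ltW t0).
  have h1 : t * t `^ nu <= B * (s - t).
    have -> : t * t `^ nu = (t `^ q) ^+ 2.
      rewrite -(powR_mulrn 2 (powR_ge0 t q)) -powRrM -{1}(powRr1 (ltW t0))
        -powRD.
        by congr (_ `^ _); rewrite /nu; ring.
      by rewrite (gt_eqF t0) implybT.
    apply: (@le_trans _ _ (C ^+ 2 * b k ^+ 2)).
      by rewrite -exprMn ler_pXn2r// ?nnegrE ?mulr_ge0 ?powR_ge0 ?(ltW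
        C_gt0)//; exact: KL.
    rewrite /B -mulrA ler_wpM2l ?sqr_ge0//.
    by rewrite -(ler_pM2l g_gt0) mulVKf ?gt_eqF//; exact: descent.
  have ts0 : 0 <= t / s by rewrite divr_ge0 ?ltW.
  have tsE : (t / s) `^ nu = t `^ nu * s `^ (- nu).
    rewrite powRM ?invr_ge0 ?(ltW t0) ?(ltW s0)//.
    by rewrite -(powR_inv1 (ltW s0)) -powRrM mulN1r.
  (* Bernoulli's inequality for the power [nu] at the ratio [t / s]. *)
  have := young_powR ts0 ler01 nu1; rewrite tsE powR1 !mulr1 => young.
  have h2 : s `^ (- nu) <= t `^ (- nu) * (1 - nu * (1 - t / s)).
    rewrite (powRN t) mulrC ler_pdivlMr// mulrC.
    by move: young; lra.
  apply: (@le_trans _ _ (t `^ (- nu) * (1 - nu * (1 - t / s)) + c)).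
    by rewrite lerD2r.
  rewrite mulrBr mulr1 -addrA gerDl addrC subr_le0.
  rewrite powRN [leRHS]mulrC ler_pdivlMr// /c.
  have -> : nu / (B + 1) * t `^ nu = nu * (t `^ nu / (B + 1)) by ring.
  rewrite ler_wpM2l ?(ltW nu0)// ler_pdivrMr//.
  have -> : (1 - t / s) * (B + 1) = (B + 1) * (s - t) / s.
    by field; rewrite gt_eqF.
  rewrite ler_pdivlMr//.
  have : t `^ nu * (s - t) <= s - t by rewrite ler_piMl// subr_ge0.
  by move: h1; lra.
have grow j : c * j%:R <= a (K + j)%N `^ (- nu).
  elim: j => [|j IH]; first by rewrite mulr0 powR_ge0.
  rewrite addnS -addn1 natrD mulrDr mulr1.
  by rewrite (le_trans _ (step _ _)) ?leq_addr// lerD2r.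
exists ((c / 2) `^ (- nu^-1)); first by rewrite powR_gt0// divr_gt0.
move=> k Kk; have k0 : 0 < k%:R :> R by rewrite ltr0n (leq_trans _ Kk).
(* The growth is counted from [K]; for [k] at least [2 * K.+1] the count [k - K] is at least half of
   [k]. *)
have h : c / 2 * k%:R <= a k `^ (- nu).
  have Kk' : (K <= k)%N.
    by rewrite (leq_trans _ Kk)// mul2n -addnn (leq_trans (leqnSn K))//
      leq_addr.
  have := grow (k - K)%N; rewrite subnKC// => h; apply: le_trans h.
  rewrite -mulrA ler_wpM2l ?(ltW c0)// natrB//.
  have : (2 * K.+1)%:R <= k%:R :> R by rewrite ler_nat.
  by rewrite natrM -(natr1 K); lra.
have -> : 1 / (1 - 2 * q) = - nu^-1.
  by rewrite /nu div1r -invrN; congr (_^-1); ring.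
have ck0 : 0 < c / 2 * k%:R by rewrite mulr_gt0// divr_gt0.
rewrite -powRM ?ler0n ?(ltW (divr_gt0 c0 (ltr0n R 2)))//.
have -> : a k = (a k `^ (- nu)) `^ (- nu^-1).
  by rewrite -powRrM mulrNN divff ?gt_eqF// powRr1// ltW.
rewrite !(powRN _ nu^-1). rewrite lef_pV2 ?posrE ?powR_gt0//.
by apply: ge0_ler_powR; rewrite ?nnegrE ?invr_ge0 ?(ltW nu0) ?powR_ge0 ?(ltW
  ck0).
Qed.

End SequenceRates.

(** The cluster point is given in advance, so the distance to it is estimated through late iterates
    close to it, and the whole sequence converges without a separate Cauchy argument. *)
Lemma convergence_rates (R : realType) (E : normedModType R) (u : nat -> E)
    (xs : E) (a b : nat -> R) (q g C L : R) :
  2^-1 <= q < 1 -> 0 < g -> 0 < C -> 0 <= L ->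
  (forall k, 0 < a k) -> (forall k, 0 <= b k) ->
  (forall k, g * b k ^+ 2 <= a k - a k.+1) ->
  (a : nat -> R^o) @ \oo --> (0 : R^o) ->
  (\forall k \near \oo, a k.+1 `^ q <= C * b k) ->
  (\forall k \near \oo, `|u k.+1 - u k| <= L * b k) ->
  cluster (u @ \oo) xs ->
  [/\ u @ \oo --> xs,
      (q = 2^-1 ->
         exists rho rhohat gamma1 : R,
           [/\ 0 < rho < 1, 0 < rhohat < 1, 0 < gamma1 &
             \forall k \near \oo,
               a k <= rho * a k.-1 /\ `|u k - xs| <= gamma1 * rhohat ^+ k]) &
      (2^-1 < q ->
         exists gamma1 gamma2 : R,
           [/\ 0 < gamma1, 0 < gamma2 &
             \forall k \near \oo,
               a k <= gamma1 * k%:R `^ (1 / (1 - 2 * q)) /\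
               `|u k - xs| <= gamma2 * k%:R `^ ((1 - q) / (1 - 2 * q))])].
Proof.
move=> q_range g0 C0 L0 a0 b0 descent a_cvg KLnear stepnear clu.
have q1 : 0 < 1 - q by move: q_range; lra.
have a_small (eps : R) : 0 < eps -> \forall k \near \oo, a k <= eps.
  move=> eps0; near=> k.
  have : `|0 - a k : R^o| <= eps.
    by near: k; apply: cvgr_dist_le.
  by rewrite sub0r normrN (ger0_norm (ltW (a0 k))).
have [K _ H] : \forall k \near \oo, [/\ a k <= 1,
    a k.+1 `^ q <= C * b k & `|u k.+1 - u k| <= L * b k].
  by near=> k; split; near: k => //; exact: a_small.
have a1 k : (K <= k)%N -> a k <= 1 by move=> /H[].
have KL k : (K <= k)%N -> a k.+1 `^ q <= C * b k by move=> /H[].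
have step k : (K <= k)%N -> `|u k.+1 - u k| <= L * b k by move=> /H[].
(* The summand 1 keeps the constant positive when [L] is 0. *)
pose T := L * (2 * (Num.sqrt g)^-1 + C / ((1 - q) * g)) + 1.
have T1 : 1 <= T.
  rewrite lerDr; apply: mulr_ge0 => //; apply: addr_ge0.
    by rewrite mulr_ge0// invr_ge0 sqrtr_ge0.
  by apply: divr_ge0; rewrite ?mulr_ge0// ltW.
have T0 : 0 < T := lt_le_trans ltr01 T1.
have dist m : (K <= m)%N -> `|u m - xs| <= T * a m `^ (1 - q).
  move=> Km; apply/ler_addgt0Pr => eps eps0.
  have Un : (u @ \oo) [set u n | n in [set n | (m <= n)%N]].
    by exists m => // n /= mn; exists n.
  have [_ [[n /= mn <-]]] := clu _ _ Un (nbhsx_ballx xs eps eps0).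
  rewrite -ball_normE /ball_/= => unx.
  rewrite (le_trans (ler_distD (u n) _ _))// lerD//; last by rewrite distrC ltW.
  rewrite distrC.
  have := iterates_dist q_range g0 C0 a0 b0 descent a1 KL L0 step
    (m := m) (n := n).
  rewrite Km mn => /(_ isT) h; apply: le_trans h _.
  by rewrite ler_wpM2r ?powR_ge0// lerDl.
have phi_small (eps : R) : 0 < eps -> \forall k \near \oo,
  T * a k `^ (1 - q) <= eps.
  move=> eps0; have e0 : 0 < eps / T by rewrite divr_gt0.
  near=> k; rewrite mulrC -ler_pdivlMr//.
  have : a k <= (eps / T) `^ (1 - q)^-1.
    by near: k; apply: a_small; exact: powR_gt0.
  move=> ak; have -> : eps / T = ((eps / T) `^ (1 - q)^-1) `^ (1 - q).
    by rewrite -powRrM mulVf ?(lt0r_neq0 q1)// powRr1// ltW.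
  by apply: ge0_ler_powR; rewrite ?nnegrE ?powR_ge0 ?(ltW q1) ?(ltW (a0 k)).
split.
- apply/cvgrPdist_le => eps eps0; near=> k.
  rewrite distrC (le_trans (dist _ _))//; near: k; last exact: phi_small.
  exact: nbhs_infty_ge.
- move=> q2.
  have [rho rho01 rhoP] := linear_rate g0 C0 a0 b0 descent KL q2.
  have rho0 : 0 < rho by case/andP: rho01.
  (* Here [1 - q] is one half, so the distance decays like the square root of the gap. *)
  pose h := rho `^ 2^-1.
  have h0 : 0 < h by exact: powR_gt0.
  have h1 : h < 1.
    rewrite /h powR12_sqrt ?(ltW rho0)// -[ltRHS]sqrtr1 ltr_sqrt//.
    by case/andP: rho01.
  have geo j : a (K + j)%N `^ 2^-1 <= a K `^ 2^-1 * h ^+ j.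
    elim: j => [|j IH]; first by rewrite addn0 expr0 mulr1.
    rewrite addnS exprSr mulrA.
    apply: (@le_trans _ _ ((rho * a (K + j)%N) `^ 2^-1)).
      apply: ge0_ler_powR; rewrite ?nnegrE ?invr_ge0 ?mulr_ge0 ?(ltW rho0)
        ?(ltW (a0 _))//.
      exact/rhoP/leq_addr.
    by rewrite powRM ?(ltW rho0) ?(ltW (a0 _))// mulrC ler_wpM2r ?(ltW h0).
  (* Dividing by [h ^+ K] compensates for the geometric decay being counted from [K]. *)
  exists rho, h, (T * a K `^ 2^-1 / h ^+ K); split => //.
  + by rewrite h0 h1.
  + by rewrite divr_gt0 ?exprn_gt0// mulr_gt0// powR_gt0.
  near=> k; have Kk : (K < k)%N by near: k; exact: nbhs_infty_gt.
  split.
    by rewrite -{1}(prednK (leq_ltn_trans (leq0n _) Kk)) rhoP// -ltnS prednK//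
      (leq_ltn_trans _ Kk).
  rewrite (le_trans (dist _ (ltnW Kk)))//.
  have -> : 1 - q = 2^-1 by rewrite q2; lra.
  rewrite -!mulrA ler_wpM2l ?(ltW T0)//.
  have := geo (k - K)%N; rewrite subnKC ?(ltnW Kk)//.
  suff -> : h ^+ (k - K) = (h ^+ K)^-1 * h ^+ k by [].
  by rewrite -[in RHS](subnKC (ltnW Kk)) exprD mulKf// expf_neq0// gt_eqF.
- move=> q2.
  have [c c0 cP] := sublinear_rate q_range g0 C0 a0 b0 descent a1 KL q2.
  exists c, (T * c `^ (1 - q)); split=> //.
    by rewrite mulr_gt0// powR_gt0.
  near=> k.
  have Kk : (2 * K.+1 <= k)%N by near: k; exact: nbhs_infty_ge.
  have ak := cP _ Kk; split=> //.
  rewrite (le_trans (dist _ _))//.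
    by rewrite (leq_trans _ Kk)// mul2n -addnn (leq_trans (leqnSn K))//
      leq_addr.
  rewrite -mulrA ler_wpM2l ?(ltW T0)//.
  have -> : (1 - q) / (1 - 2 * q) = 1 / (1 - 2 * q) * (1 - q) by rewrite div1r
    mulrC.
  rewrite powRrM -powRM ?powR_ge0 ?(ltW c0)//.
  apply: ge0_ler_powR; rewrite ?nnegrE ?mulr_ge0 ?powR_ge0 ?(ltW q1) ?(ltW c0)
    ?(ltW (a0 _))//.
Unshelve. all: by end_near. Qed.

(** * First-order expansions *)

Section ProductNorm.
Variables (R : realType) (V W : normedModType R).
Implicit Types w : V * W.

Lemma norm_fst_le w : `|w.1| <= `|w|.
Proof. by rewrite [leRHS]/Num.norm/= le_max lexx. Qed.

Lemma norm_snd_le w : `|w.2| <= `|w|.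
Proof. by rewrite [leRHS]/Num.norm/= le_max lexx orbT. Qed.

Lemma prod_norm_le w (c : R) : `|w.1| <= c -> `|w.2| <= c -> `|w| <= c.
Proof. by move=> w1 w2; rewrite [leLHS]/Num.norm/= ge_max w1. Qed.

End ProductNorm.

Section MatrixNorm.
Variables (R : realType) (m n : nat).
Implicit Types A : 'M[R]_(m, n).

Lemma norm_entry_le A i j : `|A i j| <= `|A|.
Proof.
rewrite [leRHS]/Num.Def.normr /= mx_normrE.
by apply/bigmax_geP; right; exists (i, j).
Qed.

Lemma matrix_norm_le A (c : R) : 0 <= c -> (forall i j, `|A i j| <= c) ->
  `|A| <= c.
Proof.
move=> c0 Ac; rewrite [leLHS]/Num.Def.normr /= mx_normrE.
by apply/bigmax_leP; split=> // -[i j] _ /=.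
Qed.

End MatrixNorm.

Section FirstOrder.
Variables (R : realType) (V W : normedModType R).

Lemma first_order_add (f g : V -> W) x L L' : first_order f x L ->
  first_order g x L' -> first_order (fun y => f y + g y) x (fun h => L h + L'
    h).
Proof.
move=> fL gL eps eps0; have e2 : 0 < eps / 2 by rewrite divr_gt0.
near=> y.
have -> : f y + g y - (f x + g x) - (L (y - x) + L' (y - x)) =
    (f y - f x - L (y - x)) + (g y - g x - L' (y - x)).
  by rewrite !opprD (addrACA (f y)) (addrACA (f y - f x)).
rewrite (le_trans (ler_normD _ _))// [eps]splitr mulrDl lerD//; near: y.
  exact: fL.
exact: gL.
Unshelve. all: by end_near. Qed.

Lemma near_comp_short (U : normedModType R) (P : U -> V) (A : set V) u :
  (forall w w', P (w - w') = P w - P w') -> (forall w, `|P w| <= `|w|) ->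
  (\forall y \near P u, A y) -> \forall w \near u, A (P w).
Proof.
move=> PB Pshort /nbhs_ballP[d /= d0 H].
near=> w; apply: H; rewrite -ball_normE /ball_/= -PB.
apply: le_lt_trans (Pshort _) _.
by near: w; apply: cvgr_dist_lt; first exact: cvg_id.
Unshelve. all: by end_near. Qed.

Lemma first_order_comp_short (U : normedModType R) (P : U -> V)
    (f : V -> W) u L :
  (forall w w', P (w - w') = P w - P w') -> (forall w, `|P w| <= `|w|) ->
  first_order f (P u) L ->
  first_order (fun w => f (P w)) u (fun h => L (P h)).
Proof.
move=> PB Pshort fL eps eps0.
have := near_comp_short PB Pshort (fL _ eps0); apply: filterS => w H.
by rewrite PB (le_trans H)// ler_wpM2l ?(ltW eps0)// -PB.
Qed.

Lemma first_order_post (U : normedModType R) (f : V -> W) (L : V -> W)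
    (l : W -> U) (K : R) x :
  (forall w w', l (w - w') = l w - l w') -> (forall w, `|l w| <= K * `|w|) ->
  first_order f x L -> first_order (fun y => l (f y)) x (fun h => l (L h)).
Proof.
move=> lB lK fL eps eps0; have K0 : 0 < `|K| + 1 by rewrite ltr_wpDl.
have e0 : 0 < eps / (`|K| + 1) by rewrite divr_gt0.
have := fL _ e0; apply: filterS => y H; rewrite -!lB (le_trans (lK _))//.
apply: (@le_trans _ _ ((`|K| + 1) * `|f y - f x - L (y - x)|)).
  by rewrite ler_wpM2r// ler_wpDr// ler_norm.
by rewrite -ler_pdivlMl// mulrA [_^-1 * _]mulrC.
Qed.

Lemma first_order_quadratic (b : V -> V -> R^o) (K : R) (x : V) :
  (forall u v w, b (u - v) w = b u w - b v w) ->
  (forall u v w, b w (u - v) = b w u - b w v) ->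
  (forall u v, `|b u v| <= K * `|u| * `|v|) ->
  first_order (fun w => b w w) x (fun h => b x h + b h x).
Proof.
move=> bl br bK eps eps0.
near=> y.
have -> : b y y - b x x - (b x (y - x) + b (y - x) x) = b (y - x) (y - x).
  by rewrite !bl !br; ring.
rewrite (le_trans (bK _ _))// ler_wpM2r//.
apply: (@le_trans _ _ ((`|K| + 1) * `|y - x|)).
  by rewrite ler_wpM2r// ler_wpDr// ler_norm.
rewrite -ler_pdivlMl ?ltr_wpDl// distrC.
near: y; apply: cvgr_dist_le; first exact: cvg_id.
by rewrite mulr_gt0// invr_gt0 ltr_wpDl.
Unshelve. all: by end_near. Qed.

End FirstOrder.

(** * Comparison of the two norms on the product space *)

Section PotentialSpace.
Variables (R : realType) (X : normedModType R) (dot : {dot X for idfun}).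
Hypothesis normX : norm_from dot.
Variables (p r : nat).
Local Notation W := (potential_space X p r).
Local Notation pdot := (potential_dot dot (p := p) (r := r)).
Implicit Types w : W.

Lemma potential_dotE w w' : pdot w w' = dot w.1.1.1 w'.1.1.1 +
  dot w.1.1.2 w'.1.1.2 + (\sum_i \sum_j w.1.2 i j * w'.1.2 i j) + dot w.2 w'.2.
Proof. by move: w w' => [[[x v] Q] s] [[[x' v'] Q'] s']. Qed.

Let sqE w : pdot w w = `|w.1.1.1| ^+ 2 + `|w.1.1.2| ^+ 2 +
  (\sum_i \sum_j w.1.2 i j ^+ 2) + `|w.2| ^+ 2.
Proof.
by rewrite potential_dotE !(dot_norm normX).
Qed.

(** Passes from first-order expansions and balls, taken in the library norm, to the Euclidean norm
    used for subgradients and the KL inequality. *)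
Lemma potential_norm_le w : `|w| <= dnorm pdot w.
Proof.
have entry_ge0 i j : 0 <= w.1.2 i j ^+ 2 by exact: sqr_ge0.
have row_ge0 i : 0 <= \sum_j w.1.2 i j ^+ 2 by apply: sumr_ge0.
have Q0 : 0 <= \sum_i \sum_j w.1.2 i j ^+ 2 by apply: sumr_ge0.
have x0 := sqr_ge0 `|w.1.1.1|; have v0 := sqr_ge0 `|w.1.1.2|.
have s0 := sqr_ge0 `|w.2|.
have h (t : R) : 0 <= t -> t ^+ 2 <= pdot w w -> t <= dnorm pdot w.
  move=> t0 tw; rewrite /dnorm -(ger0_norm t0) -sqrtr_sqr.
  by rewrite ler_wsqrtr.
apply: prod_norm_le; last by apply: h => //; rewrite sqE; lra.
apply: prod_norm_le; last first.
  apply: matrix_norm_le => [|i j]; first exact: sqrtr_ge0.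
  apply: h => //; rewrite sqE real_normK ?num_real//.
  have : w.1.2 i j ^+ 2 <= \sum_i \sum_j w.1.2 i j ^+ 2.
    rewrite (bigD1 i)//= (bigD1 j)//= -addrA lerDl addr_ge0//.
      by apply: sumr_ge0.
    by apply: sumr_ge0.
  by move: x0 v0 s0; lra.
by apply: prod_norm_le; apply: h => //; rewrite sqE; lra.
Qed.

(** Allows the size of a subgradient and the distance to a KL point to be bounded component by
    component. *)
Lemma potential_dnorm_le w : dnorm pdot w <=
  `|w.1.1.1| + `|w.1.1.2| + (\sum_i \sum_j `|w.1.2 i j|) + `|w.2|.
Proof.
have Q0 : 0 <= \sum_i \sum_j `|w.1.2 i j|.
  by apply: sumr_ge0 => i _; apply: sumr_ge0.
rewrite /dnorm -[leRHS]ger0_norm ?addr_ge0// -sqrtr_sqr ler_wsqrtr// sqE.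
set S := \sum_i \sum_j _ in Q0 *.
have entry i j : `|w.1.2 i j| <= S.
  rewrite /S (bigD1 i)//= (bigD1 j)//= -addrA lerDl addr_ge0//.
    by apply: sumr_ge0.
  by apply: sumr_ge0 => k _; apply: sumr_ge0.
have S2 : \sum_i \sum_j w.1.2 i j ^+ 2 <= S ^+ 2.
  rewrite expr2 {1}/S mulr_suml; apply: ler_sum => i _.
  rewrite mulr_suml; apply: ler_sum => j _.
  by rewrite -real_normK ?num_real// expr2 ler_wpM2l.
have := normr_ge0 w.1.1.1; have := normr_ge0 w.1.1.2; have := normr_ge0 w.2.
move: S2 Q0; set x := `|w.1.1.1|; set v := `|w.1.1.2|; set s := `|w.2|.
set T := \sum_i \sum_j _ => T2 S0 s0 v0 x0.
have := mulr_ge0 x0 v0; have := mulr_ge0 x0 S0; have := mulr_ge0 x0 s0.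
have := mulr_ge0 v0 S0; have := mulr_ge0 v0 s0; have := mulr_ge0 S0 s0.
by lra.
Qed.

End PotentialSpace.

(** * The subproblem and its multiplier *)

Lemma convex_combination_shift (R : pzRingType) (V : lmodType R) (t : R)
  (y a b : V) : t *: (y + a) + (1 - t) *: (y + b) = y + (b + t *: (a - b)).
Proof.
rewrite !scalerDr scalerN !scalerBl !scale1r addrACA.
by rewrite [t *: y + _]addrC subrK [t *: a + _]addrCA.
Qed.

Section Model.
Variables (R : realType) (X Z : normedModType R).
Variables (dotX : {dot X for idfun}) (dotZ : {dot Z for idfun}).
Hypotheses (normX : norm_from dotX) (normZ : norm_from dotZ).
Variables (p r : nat) (e : 'I_p -> X) (d : 'I_r -> Z).
Hypotheses (basisX : orthonormal_basis dotX e) (basisZ : orthonormal_basis dotZ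
  d).
Variables (f : X -> \bar R) (vt : Z -> R) (F : X -> Z).
Hypothesis vt_convex : convex_function setT vt.

Local Notation grad := (grad_f dotX f).
Local Notation modl := (model dotX f vt F).

Lemma grad_fE x v : dotX (grad x) v = 'd (f_real f) x v.
Proof.
rewrite /grad_f /gradient; case: xgetP => [g _ ->//|no].
have [g gP] := riesz basisX (linearP ('d (f_real f) x)).
by case: (no g).
Qed.

Lemma combine_diff_matrix x v :
  combine d (diff_matrix dotZ F e d x *m coords dotX e v) = 'd F x v.
Proof.
rewrite [RHS](basis_expansion basisZ); apply: eq_bigr => i _.
congr (_ *: _); rewrite mxE (linear_basis basisX ('d F x) v) dot_sumr.
by apply: eq_bigr => j _; rewrite !mxE dotZr mulrC.
Qed.

Lemma modelE x Q v : modl x Q v =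
  dotX (grad x) v + 2^-1 * dotX v (Q v) + vt (F x + 'd F x v) + f_real f x.
Proof. by rewrite /model /linearization [x + v]addrC addrK. Qed.

Section Minimizer.
Variables (x : X) (Q : {linear X -> X}) (T : set X) (vb : X) (alpha A : R).
Hypothesis Tsub : linear_subspace T.
Hypothesis Qsym : forall u w, dotX (Q u) w = dotX u (Q w).
Hypothesis alpha_ge0 : 0 <= alpha.
Hypothesis Qlb : forall u, alpha * dotX u u <= dotX u (Q u).
Hypothesis Qub : forall u, dotX u (Q u) <= A * dotX u u.
Hypothesis Tvb : T vb.
Hypothesis vb_min : forall u, T u -> modl x Q vb <= modl x Q u.

Lemma quad_expansion u w (t : R) :
  dotX (u + t *: w) (Q (u + t *: w)) =
  dotX u (Q u) + 2 * t * dotX (Q u) w + t ^+ 2 * dotX w (Q w).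
Proof.
rewrite linearD linearZ /= dotDl !dotDr !dotZl !dotZr.
by rewrite -(Qsym u w) (dotC dotX w (Q u)); ring.
Qed.

(** The minimizer is compared with the midpoint of [v] and [vb] only, which yields the modulus
    [alpha / 4]. *)
Lemma strong_convexity v : T v ->
  alpha / 4 * `|v - vb| ^+ 2 <= modl x Q v - modl x Q vb.
Proof.
move=> Tv; pose h := v - vb.
have Th : T (vb + 2^-1 *: h).
  rewrite addrC; apply: Tsub.2 => //.
  by rewrite /h addrC -scaleN1r; apply: Tsub.2.
have half01 : 0 <= (2^-1 : R) <= 1 by lra.
have := convex_functionE vt_convex (F x + 'd F x v) (F x + 'd F x vb) half01.
rewrite convex_combination_shift -linearB -linearZ -linearD /= -/h.
move=> conv; have := vb_min Th; rewrite !modelE quad_expansion dotDr dotZr.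
have vE : v = vb + 1 *: h by rewrite scale1r addrC subrK.
have qv := quad_expansion vb h 1; rewrite -vE in qv.
have gv : dotX (grad x) v = dotX (grad x) vb + dotX (grad x) h.
  by rewrite {1}vE scale1r dotDr.
have := Qlb h; rewrite (dot_norm normX) qv gv.
by move: conv; rewrite /h; lra.
Qed.

(** This is the domination that the Hahn-Banach extension requires: minimality at [vb + t *: u] is
    divided by [t], and the quadratic remainder vanishes as [t] tends to 0. *)
Lemma minimizer_ineq u : T u ->
  - (dotX (grad x) u + dotX (Q vb) u) <=
  vt (F x + 'd F x vb + 'd F x u) - vt (F x + 'd F x vb).
Proof.
move=> Tu; set z := F x + 'd F x vb; set D := vt (z + _) - vt z.
set c := dotX (grad x) u + dotX (Q vb) u.
have key (t : R) : 0 < t <= 1 -> 0 <= c + D + t * (2^-1 * dotX u (Q u)).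
  move=> /andP[t0 t1].
  have Tvu : T (vb + t *: u) by rewrite addrC; exact: Tsub.2.
  have t01 : 0 <= t <= 1 by rewrite ltW.
  have := convex_functionE vt_convex (z + 'd F x u) z t01.
  have -> : t *: (z + 'd F x u) + (1 - t) *: z = F x + 'd F x (vb + t *: u).
    have := convex_combination_shift t z ('d F x u) 0.
    by rewrite addr0 subr0 add0r => ->; rewrite linearD linearZ addrA.
  have := vb_min Tvu; rewrite !modelE quad_expansion dotDr dotZr -/z => h1 h2.
  rewrite -(pmulr_rge0 _ t0) /c /D.
  by move: h1 h2; lra.
rewrite lerNl -subr_ge0 opprK addrC.
have [q0|q0] := leP (dotX u (Q u)) 0.
  by have := key 1; rewrite ltr01 lexx => /(_ isT); lra.
apply/ler_addgt0Pr => eps eps0.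
(* A step for which the quadratic remainder is at most [eps]. *)
pose t := Num.min 1 (eps / (2^-1 * dotX u (Q u))).
have q20 : 0 < 2^-1 * dotX u (Q u) by rewrite mulr_gt0.
have t01 : 0 < t <= 1 by rewrite /t lt_min ltr01 divr_gt0//= ge_min lexx.
have := key t t01.
have : t * (2^-1 * dotX u (Q u)) <= eps.
  by rewrite -ler_pdivlMr// /t ge_min lexx orbT.
by lra.
Qed.

(** A functional on the image of the tangent space under ['d F x], dominated by the increments of
    [vt], is extended to all of [Z]. Its graph [G] is a relation; that [l] factors through ['d F x]
    is a consequence of the domination. *)
Lemma multiplier : exists xi,
  (forall u, dotZ xi u <=
     vt (F x + 'd F x vb + u) - vt (F x + 'd F x vb)) /\
  (forall u, T u -> dotX (grad x) u + dotX (Q vb) u + dotZ xi ('d F x u) = 0).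
Proof.
set z := F x + 'd F x vb; pose g u := vt (z + u) - vt z.
have g_convex : convex_function setT g.
  apply: convex_functionI => t u v t01; rewrite /g.
  have := convex_functionE vt_convex (z + u) (z + v) t01.
  rewrite convex_combination_shift; have := convex_combination_shift t 0 u v.
  by rewrite !add0r => <-; lra.
pose l u : R^o := - (dotX (grad x) u + dotX (Q vb) u).
pose G := [set w : Z * R^o | exists2 u, T u & w = ('d F x u, l u)].
have lP a u v : l (a *: u + v) = a * l u + l v.
  by rewrite /l !dotDr !dotZr; ring.
have [||xi [xi_le xiE]] := hahn_banach (g := g) (G := G) g_convex basisZ.
- by rewrite /g addr0 subrr.
- split; first split.
  + exists 0; first exact: Tsub.1.
    by rewrite linear0 /l !linear0r addr0 oppr0.
  + move=> a _ _ [u Tu ->] [v Tv ->]; exists (a *: u + v); first exact: Tsub.2.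
    by rewrite lP linearP.
  + by move=> w a [u Tu [-> ->]]; exact: minimizer_ineq.
exists xi; split=> // u Tu.
have := xiE ('d F x u) (l u); rewrite -/(G _) => H.
have /H <- : G ('d F x u, l u) by exists u.
by rewrite /l addrN.
Qed.

(** Cauchy-Schwarz for the semidefinite form of [Q], applied to [u] and [Q u], turns bounds on the
    quadratic form into a bound on the operator. *)
Lemma quadratic_norm u : `|Q u| <= A * `|u|.
Proof.
have [->|u0] := eqVneq u 0; first by rewrite linear0 !normr0 mulr0.
have bC w v : dotX (Q w) v = dotX (Q v) w by rewrite Qsym dotC.
have bP a u1 v1 w : dotX (Q (a *: u1 + v1)) w = a * dotX (Q u1) w + dotX (Q v1)
  w.
  by rewrite linearP dotP.
have b0 v : 0 <= dotX (Q v) v.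
  by rewrite dotC; apply: le_trans (Qlb v); rewrite mulr_ge0// dot_ge0.
have := @psd_cauchy_schwarz R X (fun u w => dotX (Q u) w) bC bP b0 u (Q u).
rewrite (dot_norm normX) => H.
have h1 := Qub u; have h2 := Qub (Q u).
rewrite !(dot_norm normX) in h1 h2.
have u20 : 0 < `|u| ^+ 2 by rewrite exprn_gt0// normr_gt0.
have A0 : 0 <= A.
  have := b0 u; rewrite dotC => b0u.
  by rewrite -(pmulr_lge0 _ u20); apply: le_trans h1.
have [->|Qu0] := eqVneq (Q u) 0; first by rewrite normr0 mulr_ge0.
have Qu20 : 0 < `|Q u| ^+ 2 by rewrite exprn_gt0// normr_gt0.
rewrite -(@ler_pXn2r _ 2)// ?nnegrE ?mulr_ge0// exprMn.
rewrite -(ler_pM2l Qu20) -expr2 (le_trans H)//.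
rewrite [leRHS](_ : _ = (A * `|u| ^+ 2) * (A * `|Q u| ^+ 2)); last by ring.
by apply: ler_pM => //; rewrite dotC.
Qed.

End Minimizer.
End Model.

(** * Continuity of differentials *)

Section OperatorContinuity.
Variables (R : realType) (X : normedModType R) (dot : {dot X for idfun}).
Hypothesis normX : norm_from dot.
Variables (p : nat) (e : 'I_p -> X).
Hypothesis basis : orthonormal_basis dot e.
Variables (Y : topologicalType) (W : normedModType R) (T : Y -> X ->
  W) (y0 : Y).
Hypothesis T_basis : forall y h, T y h = \sum_i dot (e i) h *: T y (e i).
Hypothesis T_cont : forall i, {for y0, continuous (fun y => T y (e i))}.

(** Continuity at each basis vector becomes uniform in [h]. Linearity is encoded by [T_basis], so
    that partial maps such as ['d G w (0, h)] are covered. *)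
Lemma operator_continuous (eps : R) : 0 < eps ->
  \forall y \near y0, forall h, `|T y h - T y0 h| <= eps * `|h|.
Proof.
(* The [+ 1] keeps the divisor nonzero when the basis is empty. *)
move=> eps0; have e0 : 0 < eps / (p%:R + 1) by rewrite divr_gt0// ltr_wpDl.
have Tnear : \forall y \near y0,
    forall i, `|T y (e i) - T y0 (e i)| <= eps / (p%:R + 1).
  apply: filter_forall => i; near=> y; rewrite distrC; near: y.
  by apply: cvgr_dist_le e0; exact: T_cont.
apply: filterS Tnear => y Ty h; rewrite (T_basis y) (T_basis y0) -sumrB.
rewrite (le_trans (ler_norm_sum _ _ _))//.
apply: (@le_trans _ _ (\sum_(i < p) (`|h| * (eps / (p%:R + 1))))).
  apply: ler_sum => i _; rewrite -scalerBr normrZ ler_pM//.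
  exact: norm_coord.
rewrite sumr_const card_ord -(mulr_natr (`|h| * _)).
have -> : `|h| * (eps / (p%:R + 1)) * p%:R = eps * `|h| * (p%:R / (p%:R + 1)).
  by ring.
rewrite ler_piMr ?mulr_ge0 ?(ltW eps0)//.
by rewrite ler_pdivrMr ?ltr_wpDl// mul1r lerDl.
Unshelve. all: by end_near. Qed.

Lemma operator_bounded : exists2 C : R, 0 <= C &
  \forall y \near y0, forall h, `|T y h| <= C * `|h|.
Proof.
exists (1 + \sum_i `|T y0 (e i)|); first by rewrite addr_ge0// sumr_ge0.
have := operator_continuous ltr01; apply: filterS => y Ty h.
rewrite -(subrK (T y0 h) (T y h)) (le_trans (ler_normD _ _))// mulrDl lerD//.
rewrite (T_basis y0) (le_trans (ler_norm_sum _ _ _))// mulr_suml.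
by apply: ler_sum => i _; rewrite normrZ mulrC ler_wpM2l// norm_coord.
Qed.

End OperatorContinuity.

Section SecondDifferential.
Variables (R : realType) (X : normedModType R) (dot : {dot X for idfun}).
Hypothesis normX : norm_from dot.
Variables (p : nat) (e : 'I_p -> X).
Hypothesis basis : orthonormal_basis dot e.
Variables (W : normedModType R) (U : set X) (phi : X -> W).
Hypothesis Uo : open U.
Hypothesis phi_Ck : Ck 2 U phi.

Lemma Ck2_diff2 x v : U x -> differentiable (fun y => 'd phi y v) x.
Proof. by have [_ /(_ v)[+ _]] := phi_Ck; apply. Qed.

Lemma Ck2_diff_cont x v : U x -> {for x, continuous (fun y => 'd phi y v)}.
Proof. by move=> Ux; exact/differentiable_continuous/Ck2_diff2. Qed.

(** [Ck] freezes the direction [v] before differentiating again; linearity in [v] is recovered here,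
    so that a bound uniform in [v] can be read off the basis. *)
Lemma diff2_basis x v h : U x -> 'd (fun y => 'd phi y v) x h =
  \sum_i dot (e i) v *: 'd (fun y => 'd phi y (e i)) x h.
Proof.
move=> Ux.
pose g i := dot (e i) v \*: (fun y => 'd phi y (e i)).
have dg i : differentiable (g i) x by apply: differentiableZ; exact: Ck2_diff2.
have -> : (fun y => 'd phi y v) = \sum_i g i.
  by apply/funext => y; rewrite fct_sumE (linear_basis basis).
have sumE (s : seq 'I_p) : differentiable (\sum_(i <- s) g i) x /\
    'd (\sum_(i <- s) g i) x h =
    \sum_(i <- s) dot (e i) v *: 'd (fun y => 'd phi y (e i)) x h.
  elim: s => [|i s [ds IH]].
    by rewrite !big_nil diff_cst; split=> //; exact: differentiable_cst.
  rewrite !big_cons; split; first exact: differentiableD.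
  have dD := congr1 (fun L : X -> W => L h) (diffD (dg i) ds).
  apply: etrans dD _; rewrite -[LHS]/('d (g i) x h + 'd (\sum_(j <- s) g j) x
    h).
  rewrite IH; congr (_ + _).
  exact: (congr1 (fun L : X -> W => L h) (diffZ _ (Ck2_diff2 (e i) Ux))).
by have [] := sumE (index_enum 'I_p).
Qed.

Lemma diff2_bounded x0 : U x0 -> exists2 C : R, 0 <= C &
  \forall x \near x0, forall v h, `|'d (fun y => 'd phi y v) x h| <=
    C * `|v| * `|h|.
Proof.
move=> Ux0.
have b i : exists2 C : R, 0 <= C & \forall x \near x0, forall h,
    `|'d (fun y => 'd phi y (e i)) x h| <= C * `|h|.
  apply: (operator_bounded normX basis).
    by move=> y h; exact: (linear_basis basis).
  move=> j; have [_ /(_ (e i))[_ /(_ (e j))]] := phi_Ck.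
  by move=> /(_ x0 Ux0).
pose C i := sval (cid2 (b i)).
have C0 i : 0 <= C i by rewrite /C; case: cid2.
have CP : \forall x \near x0, forall i, forall h,
    `|'d (fun y => 'd phi y (e i)) x h| <= C i * `|h|.
  by apply: filter_forall => i; rewrite /C; case: cid2.
exists (\sum_i C i); first exact: sumr_ge0.
near=> x => v h.
have Ux : U x by near: x; exact: open_nbhs_nbhs.
rewrite diff2_basis// (le_trans (ler_norm_sum _ _ _))// !mulr_suml.
apply: ler_sum => i _; rewrite normrZ mulrAC mulrC ler_pM//.
  by move: i h; near: x; exact: CP.
exact: norm_coord.
Unshelve. all: by end_near. Qed.

Lemma first_order_differential (x0 v0 : X) : U x0 ->
  first_order (fun w : X * X => 'd phi (w.1) w.2) (x0, v0)
    (fun h => 'd (fun y => 'd phi y v0) x0 h.1 + 'd phi x0 h.2).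
Proof.
move=> Ux0 eps eps0; have e2 : 0 < eps / 2 by rewrite divr_gt0.
have fo := diff_first_order (Ck2_diff2 v0 Ux0) e2.
have op := operator_continuous normX basis
  (T := fun y h => 'd phi y h) (y0 := x0)
  (fun y h => linear_basis basis _ _) (fun i => @Ck2_diff_cont x0 (e i) Ux0) e2.
have fstB (w w' : X * X) : (w - w').1 = w.1 - w'.1 by [].
have := near_comp_short fstB (@norm_fst_le _ _ _) (u := (x0, v0)) fo.
have := near_comp_short fstB (@norm_fst_le _ _ _) (u := (x0, v0)) op.
apply: filterS2 => -[x v] /= h1 h2.
have -> : 'd phi x v - 'd phi x0 v0 -
    ('d (fun y => 'd phi y v0) x0 (x - x0) + 'd phi x0 (v - v0)) =
  ('d phi x v0 - 'd phi x0 v0 - 'd (fun y => 'd phi y v0) x0 (x - x0)) +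
  ('d phi x (v - v0) - 'd phi x0 (v - v0)).
  have -> : 'd phi x v = 'd phi x v0 + 'd phi x (v - v0).
    by rewrite -linearD addrC subrK.
  by rewrite opprD (addrAC ('d phi x v0)) addrACA.
rewrite (le_trans (ler_normD _ _))// [eps]splitr mulrDl lerD//.
  rewrite (le_trans h2)// ler_wpM2l ?(ltW e2)//.
  exact: (norm_fst_le ((x, v) - (x0, v0))).
rewrite (le_trans (h1 _))// ler_wpM2l ?(ltW e2)//.
exact: (norm_snd_le ((x, v) - (x0, v0))).
Qed.

End SecondDifferential.

(** * A regular subgradient of the potential function *)

Section Subgradient.
Variables (R : realType) (X Z : normedModType R).
Variables (dotX : {dot X for idfun}) (dotZ : {dot Z for idfun}).
Hypotheses (normX : norm_from dotX) (normZ : norm_from dotZ).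
Variables (p r : nat) (e : 'I_p -> X) (d : 'I_r -> Z).
Hypotheses (basisX : orthonormal_basis dotX e) (basisZ : orthonormal_basis dotZ
  d).
Variables (f : X -> \bar R) (vt : Z -> R) (F : X -> Z) (M : set X).

Local Notation grad := (grad_f dotX f).
Local Notation W := (potential_space X p r).
Local Notation pdot := (potential_dot dotX (p := p) (r := r)).

Lemma potentialE (a : R) (w : W) : f w.1.1.1 \is a fin_num ->
  tangent_bundle M (w.1.1.1, w.1.1.2) ->
  potential dotX f vt F M e d a w =
  (f_real f w.1.1.1 + dotX w.2 w.1.1.2 +
   vt (F w.1.1.1 + combine d (w.1.2 *m coords dotX e w.1.1.2)) +
   a / 2 * dotX w.1.1.2 w.1.1.2)%:E.
Proof.
move: w => [[[x v] Q] s] /= ffin TM; rewrite asboolT//= adde0.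
by rewrite -[in LHS](fineK ffin) -!EFinD !addrA.
Qed.

Lemma potential_pinfty (a : R) (w : W) : f w.1.1.1 != -oo%E ->
  ~ tangent_bundle M (w.1.1.1, w.1.1.2) ->
  potential dotX f vt F M e d a w = +oo%E.
Proof.
move: w => [[[x v] Q] s] /= fN TM; rewrite asboolF//=.
by move: fN; case: (f x).
Qed.

Lemma combineB (z z' : 'cV[R]_r) : combine d (z - z') = combine d z - combine d
  z'.
Proof.
rewrite /combine -sumrB; apply: eq_bigr => i _.
by rewrite !mxE scalerBl.
Qed.

Lemma coordsB (v v' : X) : coords dotX e (v - v') = coords dotX e v - coords
  dotX e v'.
Proof. by apply/matrixP => i j; rewrite !mxE dotBr. Qed.

Lemma dot_combine (xi : Z) (A : 'M[R]_(r, p)) (v : X) :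
  dotZ xi (combine d (A *m coords dotX e v)) =
  \sum_i \sum_j dotZ xi (d i) * dotX (e j) v * A i j.
Proof.
rewrite dot_sumr; apply: eq_bigr => i _.
rewrite dotZr mxE mulr_suml; apply: eq_bigr => j _.
by rewrite !mxE; ring.
Qed.

Section AtPoint.
Variables (O S U V : set X) (phi psi : X -> X).
Hypothesis Oo : open O.
Hypothesis fN : forall x, f x != -oo%E.
Hypothesis f_fin : forall x, O x -> f x \is a fin_num.
Hypothesis f_diff : forall x, O x -> differentiable (f_real f) x.
Hypothesis F_diff : forall x, O x -> differentiable F x.
Hypothesis Ssub : linear_subspace S.
Hypothesis chart : slice_chart M S U V phi psi.
Variables (x : X) (vb : X) (Q : {linear X -> X}) (xi : Z) (a : R).
Hypotheses (Ux : U x) (Ox : O x) (Mx : M x).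
Hypothesis Tvb : tangent_space M x vb.
Hypothesis xi_sub : forall u,
  dotZ xi u <= vt (F x + 'd F x vb + u) - vt (F x + 'd F x vb).
Hypothesis xi_mult : forall u, tangent_space M x u ->
  dotX (grad x) u + dotX (Q vb) u + dotZ xi ('d F x u) = 0.

Let Uo : open U. Proof. by have [[]] := chart. Qed.
Let phi_Ck : Ck 2 U phi. Proof. by have [_ []] := chart. Qed.

(* n is a normal vector of M at x, and (H + n, n) is a normal vector of the
   tangent bundle at (x, vb). *)
Lemma normal_vectors : exists n H : X,
  [/\ forall u, dotX n u =
        - (dotX (grad x) u + dotX (Q vb) u + dotZ xi ('d F x u)),
      forall u, S u -> dotX n ('d psi (phi x) u) = 0 &
      forall h, dotX H h =
        dotX n ('d psi (phi x) ('d (fun y => 'd phi y vb) x h))].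
Proof.
have [|n nE] := @riesz R X dotX p e basisX (fun u =>
  - (dotX (grad x) u + dotX (Q vb) u + dotZ xi ('d F x u))) _.
  by move=> c u v; rewrite (linearP ('d F x)) !dotDr !dotZr; ring.
have [|H HE] := @riesz R X dotX p e basisX (fun h =>
  dotX n ('d psi (phi x) ('d (fun y => 'd phi y vb) x h))) _.
  by move=> c u v; rewrite !(linearP ('d _ _)) dotDr dotZr.
exists n, H; split=> // u Su; rewrite nE.
have Tu : tangent_space M x ('d psi (phi x) u).
  by apply/(tangent_chart normX basisX Ssub chart _ Ux Mx);
    rewrite (chart_diffVK chart).
by rewrite xi_mult// oppr0.
Qed.

Variables n H : X.
Hypothesis nE : forall u, dotX n u =
  - (dotX (grad x) u + dotX (Q vb) u + dotZ xi ('d F x u)).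
Hypothesis nS : forall u, S u -> dotX n ('d psi (phi x) u) = 0.
Hypothesis HE : forall h, dotX H h =
  dotX n ('d psi (phi x) ('d (fun y => 'd phi y vb) x h)).

(* In the x-component, H is the curvature term of the normal vector (H + n, n)
   of the tangent bundle; the first-order terms have cancelled against n by the
   optimality condition. *)
Definition subgradient : W :=
  (H - Q vb, a *: vb - Q vb, \matrix_(i, j) (dotZ xi (d i) * dotX (e j) vb),
    vb).

Let w0 : W := potential_iterate dotX dotZ f F e d x vb.

(** By [nS] this functional vanishes on [S]. Hence [l (phi y)] vanishes on [M] and the function [c]
    below on the tangent bundle: adding both leaves the potential unchanged there, while their
    differentials contribute the normal parts [n] and [(H, n)]. *)
Let l u : R^o := dotX n ('d psi (phi x) u).

Let lB u v : l (u - v) = l u - l v.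
Proof. by rewrite /l linearB dotBr. Qed.

Let l_le u : `|l u| <= `|n| * (\sum_i `|'d psi (phi x) (e i)|) * `|u|.
Proof.
rewrite /l (le_trans (cauchy_schwarz normX _ _))// -mulrA ler_wpM2l//.
exact: (linear_le normX basisX).
Qed.

Let A (y : X) : R^o := f_real f y + (dotZ xi (F y) : R^o) + l (phi y).

Let A_fo : first_order A x (fun h => dotX (grad x) h + dotZ xi ('d F x h) +
  dotX n h).
Proof.
have dphi := chart_diff chart Ux.
have fo1 := diff_first_order (f_diff Ox).
have fo2 : first_order (fun y => dotZ xi (F y) : R^o) x (fun h => dotZ xi ('d F
  x h)).
  apply: first_order_post (diff_first_order (F_diff Ox)).
    by move=> w w'; rewrite dotBr.
  by move=> w; exact: cauchy_schwarz.
have fo3 := first_order_post lB l_le (diff_first_order dphi).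
move=> eps /(first_order_add (first_order_add fo1 fo2) fo3).
apply: filterS => y; rewrite /l (chart_diffK chart)//.
by rewrite (grad_fE basisX).
Qed.

(** The terms of the potential bilinear in the variables, with [vt] replaced by its affine minorant
    of slope [xi]. *)
Let b (w w' : W) : R^o := dotX w.2 w'.1.1.2 +
  dotZ xi (combine d (w.1.2 *m coords dotX e w'.1.1.2)) +
  a / 2 * dotX w.1.1.2 w'.1.1.2.

Let b_fo : first_order (fun w => b w w) w0 (fun h => b w0 h + b h w0).
Proof.
pose K := 1 + (\sum_i \sum_(j < p) `|dotZ xi (d i)|) + `|a / 2|.
apply: (@first_order_quadratic _ _ b K).
- move=> u v w; rewrite /b !dotBl mulmxBl combineB dotBr.
  by ring.
- move=> u v w; rewrite /b !dotBr coordsB mulmxBr combineB dotBr.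
  by ring.
move=> w w'.
have w2 := norm_snd_le w; have w1 := norm_fst_le w.
have w12 := le_trans (norm_snd_le w.1) w1.
have w11 := le_trans (norm_fst_le w.1) w1.
have w112 := le_trans (norm_snd_le w.1.1) w11.
have w'112 := le_trans (norm_snd_le w'.1.1) (le_trans (norm_fst_le w'.1)
  (norm_fst_le w')).
rewrite /b /K -[leRHS]mulrA !mulrDl mul1r (le_trans (ler_normD _ _))// lerD//.
  rewrite (le_trans (ler_normD _ _))// lerD//.
    by rewrite (le_trans (cauchy_schwarz normX _ _))// ler_pM.
  rewrite dot_combine mulr_suml (le_trans (ler_norm_sum _ _ _))//.
  apply: ler_sum => i _.
  rewrite mulr_suml (le_trans (ler_norm_sum _ _ _))//; apply: ler_sum => j _.
  rewrite !normrM -mulrA ler_wpM2l// mulrC ler_pM//.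
    exact: le_trans (norm_entry_le _ _ _) w12.
  exact: le_trans (norm_coord normX basisX _ _) w'112.
by rewrite normrM ler_wpM2l// (le_trans (cauchy_schwarz normX _ _))// ler_pM.
Qed.

Let c (y : X * X) : R^o := l ('d phi (y.1) y.2).

Let c_fo : first_order c (x, vb) (fun h => dotX H h.1 + dotX n h.2).
Proof.
have := first_order_differential normX basisX phi_Ck vb Ux.
move=> /(first_order_post lB l_le) fo eps /fo; apply: filterS => y.
by rewrite /l linearD (chart_diffK chart)// dotDr HE.
Qed.

Let proj_x (w : W) := w.1.1.1.
Let proj_xv (w : W) : X * X := w.1.1.

Let proj_x_le w : `|proj_x w| <= `|w|.
Proof. exact: le_trans (norm_fst_le _) (le_trans (norm_fst_le _) (norm_fst_le
  _)). Qed.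

Let proj_xv_le w : `|proj_xv w| <= `|w|.
Proof. exact: le_trans (norm_fst_le _) (norm_fst_le _). Qed.

Let subgradientE w : dotX (grad x) (proj_x w) + dotZ xi ('d F x (proj_x w)) +
    dotX n (proj_x w) + (b w0 w + b w w0) +
    (dotX H (proj_xv w).1 + dotX n (proj_xv w).2) = pdot subgradient w.
Proof.
move: w => [[[x' v'] Q'] s']; rewrite /proj_x /proj_xv /b /=.
rewrite (combine_diff_matrix basisX basisZ) dot_combine !nE !dotBl dotZl.
rewrite (dotC dotX s' vb) (dotC dotX v' vb).
set B := \sum_i \sum_j _; set B' := \sum_i \sum_j _.
have -> : B' = B.
  by apply: eq_bigr => i _; apply: eq_bigr => j _; rewrite mxE.
by field.
Qed.

(** Outside the tangent bundle the potential is infinite. On it, up to a constant, the potential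
    dominates the sum of [A], [b] and [c], with equality at [w0]; the differential of that sum at
    [w0] is [subgradient]. *)
Lemma subgradient_regular :
  regular_subdiff pdot (potential dotX f vt F M e d a) w0 subgradient.
Proof.
have TM : tangent_bundle M (x, vb) by [].
have Xi0 := @potentialE a w0 (f_fin Ox) TM.
split; first by rewrite Xi0.
move=> eps eps0.
have Pxv : forall w w' : W, proj_xv (w - w') = proj_xv w - proj_xv w' by [].
have Px : forall w w' : W, proj_x (w - w') = proj_x w - proj_x w' by [].
have fo1 := first_order_comp_short Px proj_x_le (u := w0) A_fo.
have fo2 := first_order_comp_short Pxv proj_xv_le (u := w0) c_fo.
have fo := first_order_add (first_order_add fo1 b_fo) fo2 eps0.
have UO : \forall w \near w0, U (proj_x w) /\ O (proj_x w).
  apply: (near_comp_short (P := proj_x) (A := fun y => U y /\ O y) Px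
    proj_x_le).
  by apply: filterI; exact: open_nbhs_nbhs.
near=> w.
have [Uw Ow] : U (proj_x w) /\ O (proj_x w) by near: w.
have [TMw|nTM] := pselect (tangent_bundle M (w.1.1.1, w.1.1.2)); last first.
  by rewrite (potential_pinfty a (fN _) nTM) leey.
rewrite Xi0 (potentialE a (f_fin Ow) TMw) -EFinD lee_fin.
have key := near fo w; rewrite subgradientE in key.
have {key} := le_trans (key _) (ler_wpM2l (ltW eps0) (potential_norm_le normX
  (w - w0))).
rewrite ler_norml => /(_ _)/andP[//|+ _].
have lphi y u : U y -> tangent_bundle M (y, u) -> l (phi y) = 0 /\ c (y, u) = 0.
  move=> Uy [/= My Ty]; split; apply: nS.
    by have [_ _ _ _ MS] := chart; apply/MS.
  exact/(tangent_chart normX basisX Ssub chart _ Uy My).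
have [lw cw] := lphi _ _ Uw TMw; have [l0 c0] := lphi _ _ Ux TM.
set P := pdot subgradient (w - w0); set N := eps * _.
have {}cw : c (proj_xv w) = 0 := cw.
have {}c0 : c (proj_xv w0) = 0 := c0.
have {}lw : l (phi (proj_x w)) = 0 := lw.
have {}l0 : l (phi (proj_x w0)) = 0 := l0.
rewrite cw c0 /A lw l0.
have := xi_sub (F w.1.1.1 + combine d (w.1.2 *m coords dotX e w.1.1.2) - (F x +
  'd F x vb)).
rewrite [F x + _ + _]addrC subrK /b /proj_x /= (combine_diff_matrix basisX
  basisZ).
rewrite dotBr !dotDr => h1 h2; move: h1 h2 => /=; lra.
Unshelve. all: by end_near. Qed.

End AtPoint.
End Subgradient.

(** * Estimates near a point of the manifold *)

Section SubgradientNorm.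
Variables (R : realType) (X Z : normedModType R).
Variables (dotX : {dot X for idfun}) (dotZ : {dot Z for idfun}).
Hypotheses (normX : norm_from dotX) (normZ : norm_from dotZ).
Variables (p r : nat) (e : 'I_p -> X) (d : 'I_r -> Z).
Hypotheses (basisX : orthonormal_basis dotX e) (basisZ : orthonormal_basis dotZ
  d).

Lemma norm_le_of_dot (E : normedModType R) (dot : {dot E for idfun}) (u : E) (c
  : R) :
  norm_from dot -> 0 <= c -> dot u u <= c * `|u| -> `|u| <= c.
Proof.
move=> normE c0; rewrite (dot_norm normE) expr2.
have [->|u0] := eqVneq u 0; first by rewrite normr0.
by rewrite ler_pM2r// normr_gt0.
Qed.

Lemma subgradient_dnorm (vb H : X) (Q : {linear X -> X}) (xi : Z) (a A CH : R) :
  `|Q vb| <= A * `|vb| -> `|H| <= CH * `|vb| ->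
  dnorm (potential_dot dotX (p := p) (r := r))
    (subgradient dotX dotZ e d vb Q xi a H) <=
  (CH + A + `|a| + A + (r * p)%:R * `|xi| + 1) * `|vb|.
Proof.
move=> QA HC; rewrite (le_trans (potential_dnorm_le normX _))//= !mulrDl mul1r.
rewrite lerD2r -(addrA (CH * `|vb| + _)); apply: lerD; first apply: lerD.
- by rewrite (le_trans (ler_normB _ _))// lerD.
- by rewrite (le_trans (ler_normB _ _))// normrZ lerD.
apply: (@le_trans _ _ (\sum_(i < r) \sum_(j < p) (`|xi| * `|vb|))).
  apply: ler_sum => i _; apply: ler_sum => j _; rewrite mxE normrM ler_pM//.
    by rewrite (dotC dotZ); apply: (norm_coord normZ basisZ).
  exact: (norm_coord normX basisX).
rewrite !sumr_const !card_ord -mulrnA mulnC -mulrA -[leLHS]mulr_natl.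
by rewrite mulrA.
Qed.

End SubgradientNorm.

Lemma C11_diff_cont (R : realType) (V W : normedModType R) (O : set V)
  (f : V -> W) x v : C11 O f -> O x -> {for x, continuous (fun y => 'd f y v)}.
Proof.
move=> [_ Lip] Ox; have [L [U Ux LU]] := Lip _ Ox.
apply/cvgrPdist_le => eps eps0; near=> y.
have Uy : U y by near: y.
rewrite (le_trans (LU _ _ _ (nbhs_singleton Ux) Uy))//.
apply: (@le_trans _ _ ((`|L| * `|v| + 1) * `|x - y|)).
  rewrite mulrAC ler_wpM2r// (le_trans _ (ler_wpDr ler01 (lexx _)))//.
  by rewrite ler_wpM2r// ler_norm.
rewrite -ler_pdivlMl ?ltr_wpDl ?mulr_ge0//.
near: y; apply: cvgr_dist_le; first exact: cvg_id.
by rewrite mulr_gt0// invr_gt0 ltr_wpDl ?mulr_ge0.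
Unshelve. all: by end_near. Qed.

(** * Mean value inequality and displacement under a retraction *)

Section LocalLipschitz.
Variables (R : realType) (X : normedModType R) (dot : {dot X for idfun}).
Hypothesis normX : norm_from dot.
Variables (p : nat) (e : 'I_p -> X).
Hypothesis basis : orthonormal_basis dot e.

Lemma dot_is_diff (a y : X) :
  is_diff y (fun u => dot a u : R^o) (fun u => dot a u : R^o).
Proof.
have L_lin : linear (fun u => dot a u : R^o).
  by move=> c u v; rewrite dotDr dotZr.
pose Llin := GRing.isLinear.Build _ _ _ _ (fun u => dot a u : R^o) L_lin.
pose L : {linear X -> R^o} := HB.pack (fun u => dot a u : R^o) Llin.
have Lc := linear_fin_continuous normX basis (L := L).
by apply: DiffDef; [exact: (linear_differentiable (f :=
  L) _ Lc)|exact: (diff_lin (f := L) _ Lc)].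
Qed.

(** The vector-valued increment is reduced to the scalar mean value theorem by pairing [G] with the
    increment itself. *)
Lemma segment_mean_value (V : normedModType R) (G : V -> X) (y h : V) (C : R) :
  (forall t : R, 0 <= t <= 1 ->
    differentiable G (y + t *: h) /\ `|'d G (y + t *: h) h| <= C) ->
  `|G (y + h) - G y| <= C.
Proof.
move=> dG.
have C0 : 0 <= C.
  have [|_] := dG 0; first by rewrite lexx ler01.
  exact: le_trans.
pose a := G (y + h) - G y.
pose g (t : R) := dot a (G (y + t *: h)).
have gd (t : R) : 0 <= t <= 1 -> is_derive t 1 g (dot a ('d G (y + t *: h) h)).
  move=> t01; have dl := is_diff_affine y h t.
  have [dGt _] := dG _ t01.
  have dGl := diff_comp (ex_diff (is_diff_def := dl)) dGt.
  have dda := dot_is_diff a (G (y + t *: h)).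
  have exl : differentiable (G \o (fun t : R^o => y + t *: h)) t.
    exact: (differentiable_comp (ex_diff (is_diff_def := dl)) dGt).
  have dg := diff_comp exl (ex_diff (is_diff_def := dda)).
  have exg := differentiable_comp exl (ex_diff (is_diff_def := dda)).
  apply: DeriveDef; first exact: (diff_derivable exg).
  rewrite -[g]/((fun u => dot a u : R^o) \o (G \o (fun t : R^o => y + t *: h))).
  rewrite deriveE// dg /= (diff_val (is_diff_def := dda)) dGl /=.
  by rewrite (diff_val (is_diff_def := dl)) scale1r.
have [||c c01] := @MVT R g (fun t => dot a ('d G (y + t *: h) h)) 0 1 ltr01.
- move=> t; rewrite in_itv/= => /andP[t0 t1]; apply: gd.
  by rewrite !ltW.
- apply: derivable_within_continuous => t; rewrite in_itv/= => t01.
  exact: (@ex_derive _ _ _ _ _ _ _ (gd _ t01)).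
rewrite subr0 mulr1 /g scale1r scale0r addr0 -dotBr -/a => E.
apply: (norm_le_of_dot normX C0); rewrite -/a E.
have c01' : 0 <= c <= 1 by move: c01; rewrite in_itv/= => /andP[/ltW-> /ltW->].
have [_ dGc] := dG _ c01'.
rewrite (le_trans (ler_norm _))// (le_trans (cauchy_schwarz normX _ _))//.
by rewrite mulrC ler_wpM2r.
Qed.

(** Since [Ret y 0 = y], the displacement is an increment of the local extension [G] along the fibre
    segment from [(w.1, 0)] to [w]. The segment is followed in the open domain of [G], so only its
    endpoints have to lie in the tangent bundle. *)
Lemma retraction_lipschitz (M : set X) (Ret : X -> X -> X) (xb : X) :
  retraction M Ret -> tangent_bundle M (xb, 0) ->
  exists2 C : R, 0 <= C & \forall w \near (xb, 0 : X),
    tangent_bundle M w -> tangent_bundle M (w.1, 0) ->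
    `|Ret w.1 w.2 - w.1| <= C * `|w.2|.
Proof.
move=> [_ ext Ret0 _] TM0; have [U [G [Uo U0 GCk GE]]] := ext _ TM0.
have [dG _] := GCk.
have [C C0 GC] : exists2 C : R, 0 <= C &
    \forall w \near (xb, 0 : X), forall h : X, `|'d G w (0, h)| <= C * `|h|.
  apply: (@operator_bounded R X dot normX p e basis _ _
    (fun (w : X * X) (h : X) => 'd G w (0, h))).
    move=> w h.
    have -> : (0 : X, h) = \sum_i dot (e i) h *: (0 : X, e i).
      rewrite {1}(basis_expansion basis h).
      elim/big_rec2: _ => // i u v _ <-; rewrite -[RHS]/(_ *: 0 + 0,
        _ *: e i + v).
      by rewrite scaler0 addr0.
    by rewrite linear_sum; apply: eq_bigr => i _; rewrite linearZ.
  move=> i; have [_ /(_ (0, e i))[dG2 _]] := GCk.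
  exact/differentiable_continuous/dG2.
exists C => //.
have Unear : \forall w \near (xb, 0 : X), U w by exact: open_nbhs_nbhs.
have : \forall w \near (xb, 0 : X),
    U w /\ forall h : X, `|'d G w (0, h)| <= C * `|h| by exact: filterI.
move=> /nbhs_ballP[rho /= rho0 ball_rho].
near=> w => TMw TMw0.
have wrho : `|(xb, 0 : X) - w| < rho.
  by near: w; apply: cvgr_dist_lt => //; exact: cvg_id.
(* In the max norm, shrinking the second component cannot leave a ball centred at [(xb, 0)]. *)
have seg (t : R) : 0 <= t <= 1 -> ball (xb, 0 : X) rho ((w.1, 0) + t *: (0,
  w.2)).
  move=> /andP[t0 t1]; rewrite -ball_normE /ball_/=; apply: le_lt_trans wrho.
  have -> : (xb, 0 : X) - ((w.1, 0) + t *: (0, w.2)) = (xb - w.1, - (t *: w.2)).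
    rewrite -[LHS]/(xb - (w.1 + t *: 0), 0 - (0 + t *: w.2)).
    by rewrite scaler0 addr0 !add0r.
  have h2 : `|(0 : X) - w.2| <= `|(xb, 0 : X) - w| := norm_snd_le ((xb,
    0 : X) - w).
  rewrite sub0r normrN in h2.
  apply: prod_norm_le; first exact: (norm_fst_le ((xb, 0 : X) - w)).
  rewrite /= normrN normrZ ger0_norm// (le_trans _ h2)//.
  by rewrite ler_piMl.
have := @segment_mean_value _ G (w.1, 0) (0, w.2) (C * `|w.2|) _.
have wE : (w.1, 0) + (0, w.2) = w :> X * X.
  by rewrite [RHS]surjective_pairing -[LHS]/(w.1 + 0, 0 + w.2) addr0 add0r.
have U1 : U w by rewrite -wE -[(0, w.2)]scale1r; case: (ball_rho _ (seg 1 _));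
  rewrite ?lexx ?ler01.
have U2 : U (w.1, 0).
  by rewrite -[(w.1, 0)]addr0 -(scale0r (0, w.2));
    case: (ball_rho _ (seg 0 _)); rewrite ?lexx ?ler01.
rewrite wE -(GE _ U1 TMw) -(GE _ U2 TMw0) /= Ret0; last by case: TMw0.
apply=> t t01; have [Ut dGt] := ball_rho _ (seg t t01).
by split; [exact: dG|exact: dGt].
Unshelve. all: by end_near. Qed.

End LocalLipschitz.

Section LocalEstimates.
Variables (R : realType) (X Z : normedModType R).
Variables (dotX : {dot X for idfun}) (dotZ : {dot Z for idfun}).
Hypotheses (normX : norm_from dotX) (normZ : norm_from dotZ).
Variables (p r : nat) (e : 'I_p -> X) (d : 'I_r -> Z).
Hypotheses (basisX : orthonormal_basis dotX e) (basisZ : orthonormal_basis dotZ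
  d).

Lemma tangent_space_linear (M : set X) x : C2_embedded_submanifold M -> M x ->
  linear_subspace (tangent_space M x).
Proof.
move=> [S Ssub charts] Mx; have [U [V [phi [psi [Ux chart]]]]] := charts _ Mx.
have TE u := tangent_chart normX basisX Ssub chart u Ux Mx.
split; first by apply/TE; rewrite linear0; exact: Ssub.1.
by move=> a u v /TE Su /TE Sv; apply/TE; rewrite linearP; exact: Ssub.2.
Qed.

Variables (f : X -> \bar R) (vt : Z -> R) (F : X -> Z) (M O : set X).
Hypothesis assumptions : standing_assumptions f vt F M O.

Local Notation grad := (grad_f dotX f).
Local Notation pdot := (potential_dot dotX (p := p) (r := r)).
Local Notation iterate := (potential_iterate dotX dotZ f F e d).

Let Mcharts : C2_embedded_submanifold M. Proof. by have [[]] := assumptions.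
  Qed.
Let Oo : open O. Proof. by have [_ []] := assumptions. Qed.
Let MO : M `<=` O. Proof. by have [_ []] := assumptions. Qed.
Let fN y : f y != -oo%E. Proof. by have [_ _ []] := assumptions. Qed.
Let f_fin y : O y -> f y \is a fin_num. Proof. by have [_ _ [_ _ _ + _] _ _] :=
  assumptions; apply. Qed.
Let f_C11 : C11 O (f_real f). Proof. by have [_ _ []] := assumptions. Qed.
Let F_C11 : C11 O F. Proof. by have [_ _ _ _ []] := assumptions. Qed.
Let vt_convex : convex_function setT vt. Proof. by case: assumptions. Qed.

Definition objective (y : X) : R := f_real f y + vt (F y).

Lemma ThetaE y : O y -> Theta f vt F y = (objective y)%:E.
Proof. by move=> Oy; rewrite /Theta -(fineK (f_fin Oy)). Qed.

Definition potential_value (a : R) (y v : X) : R :=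
  f_real f y + 'd (f_real f) y v + vt (F y + 'd F y v) + a / 2 * `|v| ^+ 2.

Lemma potential_iterateE a y v : tangent_bundle M (y, v) ->
  potential dotX f vt F M e d a (iterate y v) = (potential_value a y v)%:E.
Proof.
move=> TM; have Oy := MO TM.1; rewrite potentialE//=; last exact: f_fin.
by rewrite (grad_fE basisX) (combine_diff_matrix basisX basisZ) (dot_norm
  normX).
Qed.

Variable xb : X.
Hypothesis Mxb : M xb.
Let Oxb : O xb := MO Mxb.

Lemma C11_cvg (W : normedModType R) (g : X -> W) : C11 O g ->
  {for xb, continuous g}.
Proof. by move=> [dg _]; exact/differentiable_continuous/dg. Qed.

Lemma C11_operator_bounded (W : normedModType R) (g : X -> W) : C11 O g ->
  exists2 C : R, 0 <= C & \forall y \near xb, forall h, `|'d g y h| <= C * `|h|.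
Proof.
move=> gC; apply: (@operator_bounded R X dotX normX p e basisX _ _ (fun y h =>
  'd g y h)).
  by move=> y h; exact: (linear_basis basisX).
by move=> i; exact: C11_diff_cont gC Oxb.
Qed.

Lemma C11_operator_continuous (W : normedModType R) (g : X -> W) (eps : R) :
  C11 O g -> 0 < eps ->
  \forall y \near xb, forall h, `|'d g y h - 'd g xb h| <= eps * `|h|.
Proof.
move=> gC; apply: (@operator_continuous R X dotX normX p e basisX _ _ (fun y h
  => 'd g y h)).
  by move=> y h; exact: (linear_basis basisX).
by move=> i; exact: C11_diff_cont gC Oxb.
Qed.

Lemma near_fst (P : set X) : (\forall y \near xb, P y) ->
  \forall w \near (xb, 0 : X), P w.1.
Proof. by move=> Py; have := @cvg_fst _ _ (nbhs xb) (nbhs (0 : X)) _; apply.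
  Qed.

Lemma near_snd (P : set X) : (\forall v \near (0 : X), P v) ->
  \forall w \near (xb, 0 : X), P w.2.
Proof. by move=> Py; have := @cvg_snd _ _ (nbhs xb) (nbhs (0 : X)) _; apply.
  Qed.

Lemma near_norm_snd (eps : R) : 0 < eps -> \forall w \near (xb, 0 : X),
  `|w.2| <= eps.
Proof.
by move=> eps0; apply: (near_snd (P := fun v => `|v| <= eps)); exact: nbhs0_le.
Qed.

Lemma C11_diff_cvg0 (W : normedModType R) (g : X -> W) : C11 O g ->
  'd g (w.1) w.2 @[w --> (xb, 0 : X)] --> (0 : W).
Proof.
move=> gC; have [C C0 HC] := C11_operator_bounded gC.
apply/cvgrPdist_le => eps eps0; near=> w.
rewrite sub0r normrN.
have h : `|'d g (w.1) w.2| <= C * `|w.2|.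
  by move: (w.2); near: w; exact: (near_fst HC).
rewrite (le_trans h)// (@le_trans _ _ ((C + 1) * `|w.2|))//.
  by rewrite ler_wpM2r// lerDl.
rewrite -ler_pdivlMl ?ltr_wpDl//; near: w; apply: near_norm_snd.
by rewrite mulr_gt0// invr_gt0 ltr_wpDl.
Unshelve. all: by end_near. Qed.

(** Brings the iterates into the value window of the KL inequality. *)
Lemma potential_value_cvg a :
  (potential_value a w.1 w.2 : R^o) @[w --> (xb, 0 : X)] -->
    (objective xb : R^o).
Proof.
have fst_cvg : w.1 @[w --> (xb, 0 : X)] --> xb by exact: cvg_fst.
have snd_cvg : w.2 @[w --> (xb, 0 : X)] --> (0 : X) by exact: cvg_snd.
have -> : objective xb = f_real f xb + 0 + vt (F xb + 0) + a / 2 * `|0 : X| ^+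
  2.
  by rewrite normr0 expr0n mulr0 !addr0.
apply: cvgD; first apply: cvgD; first apply: cvgD.
- exact: cvg_comp fst_cvg (C11_cvg f_C11).
- exact: C11_diff_cvg0.
- have Fc : (F w.1 + 'd F (w.1) w.2) @[w --> (xb, 0 : X)] --> F xb + 0.
    apply: cvgD; last exact: C11_diff_cvg0.
    exact: cvg_comp fst_cvg (C11_cvg F_C11).
  exact: cvg_comp Fc (convex_continuous normZ basisZ vt_convex (x := _)).
- have Nc : `|w.2| @[w --> (xb, 0 : X)] --> `|0 : X| by exact: cvg_norm.
  have := cvgM (cvg_cst (a / 2 : R)) (cvgM Nc Nc).
  by apply.
Qed.

(** Brings the iterates into the ball of the KL inequality, and shows that cluster points of [x]
    lift to cluster points of [w]. *)
Lemma iterate_near (eps : R) : 0 < eps -> \forall w \near (xb, 0 : X),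
  dnorm pdot (iterate w.1 w.2 - iterate xb 0) <= eps.
Proof.
move=> eps0; pose k : R := (r * p)%:R + 3.
have k0 : 0 < k by rewrite ltr_wpDl.
have ek : 0 < eps / k by rewrite divr_gt0.
have fo := near_fst (C11_operator_continuous f_C11 ek).
have Fo := near_fst (C11_operator_continuous F_C11 ek).
near=> w; rewrite (le_trans (potential_dnorm_le normX _))//=.
have h1 : `|w.1 - xb| <= eps / k.
  rewrite distrC; near: w; apply: (near_fst (P := fun y => `|xb - y| <=
    eps / k)).
  by apply: cvgr_dist_le; [exact: cvg_id|].
have h2 : `|w.2 - 0| <= eps / k by rewrite subr0; near: w; exact: near_norm_snd.
have h3 : `|grad w.1 - grad xb| <= eps / k.
  apply: (norm_le_of_dot normX (ltW ek)).
  rewrite {1}dotBl !(grad_fE basisX) (le_trans (ler_norm _))//.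
  by move: (grad _ - grad _); near: w.
have h4 : \sum_i \sum_j `|(diff_matrix dotZ F e d w.1 - diff_matrix dotZ F e d
  xb) i j|
    <= (r * p)%:R * (eps / k).
  apply: (@le_trans _ _ (\sum_(i < r) \sum_(j < p) (eps / k))).
    apply: ler_sum => i _; apply: ler_sum => j _.
    rewrite !mxE -dotBr (le_trans (norm_coord normZ basisZ _ _))//.
    have : `|'d F (w.1) (e j) - 'd F xb (e j)| <= eps / k * `|e j|.
      by move: (e j); near: w.
    by rewrite (norm_basis normX basisX) mulr1.
  by rewrite !sumr_const !card_ord -mulrnA mulnC mulr_natl.
rewrite -[leRHS](divfK (lt0r_neq0 k0)).
have kE (t : R) : t * k = t + t + (r * p)%:R * t + t by rewrite /k; ring.
rewrite kE.
by rewrite !lerD.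
Unshelve. all: by end_near. Qed.

(** The constant is chosen before [w] and [Q]: every differential and subgradient involved is
    bounded on a neighbourhood of [xb], and [Q] enters only through [A]. This makes it valid for all
    iterations that visit the neighbourhood. *)
Lemma subgradient_near (a A : R) : 0 <= A -> exists2 C : R, 0 <= C &
  \forall w \near (xb, 0 : X), forall Q : {linear X -> X},
    (forall u u', dotX (Q u) u' = dotX u (Q u')) ->
    (forall u, 0 <= dotX u (Q u) <= A * dotX u u) ->
    tangent_bundle M w ->
    (forall u, tangent_space M w.1 u ->
       model dotX f vt F w.1 Q w.2 <= model dotX f vt F w.1 Q u) ->
  exists2 s, regular_subdiff pdot (potential dotX f vt F M e d a) (iterate w.1
    w.2) s &
    dnorm pdot s <= C * `|w.2|.
Proof.
move=> A0; have [S Ssub charts] := Mcharts.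
have [U [V [phi [psi [Uxb chart]]]]] := charts _ Mxb.
have [[Uo Vo] [phiCk psiCk] phiV psiU MS] := chart.
have [Cf Cf0 fC] := C11_operator_bounded f_C11.
have [CF CF0 FC] := C11_operator_bounded F_C11.
have [CD CD0 DC] := diff2_bounded normX basisX Uo phiCk Uxb.
have [CB CB0 BC] : exists2 C : R, 0 <= C &
    \forall y \near xb, forall h, `|'d psi (phi y) h| <= C * `|h|.
  apply: (@operator_bounded R X dotX normX p e basisX _ _ (fun y h => 'd psi
    (phi y) h)).
    by move=> y h; exact: (linear_basis basisX).
  move=> i; apply: (@continuous_comp _ _ _ phi (fun z => 'd psi z (e i))).
    exact: differentiable_continuous (chart_diff chart Uxb).
  by apply: (Ck2_diff_cont psiCk); exact: (phiV _ Uxb).1.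
have [Cx Cx0 xiC] := convex_subgradient_bounded normZ basisZ vt_convex (F xb).
(* Bounds the normal vector term by term through its defining formula, with [Q w.2] at most [A] in
   norm because [w.2] is kept in the unit ball. *)
pose Cn := Cf + A + Cx * CF.
have Cn0 : 0 <= Cn by rewrite !addr_ge0// mulr_ge0.
pose CH := Cn * (CB * CD).
exists (CH + A + `|a| + A + (r * p)%:R * Cx + 1).
  by rewrite !addr_ge0// !mulr_ge0.
have Unear := near_fst (open_nbhs_nbhs (conj Uo Uxb)).
have fC' := near_fst fC; have FC' := near_fst FC.
have DC' := near_fst DC; have BC' := near_fst BC.
have xiC' : \forall w \near (xb, 0 : X), forall xi,
    (forall u, dotZ xi u <= vt (F w.1 + 'd F (w.1) w.2 + u) - vt (F w.1 + 'd F
      (w.1) w.2)) ->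
    `|xi| <= Cx.
  have Fc : (F w.1 + 'd F (w.1) w.2) @[w --> (xb, 0 : X)] --> F xb.
    rewrite -[F xb]addr0; apply: cvgD; last exact: C11_diff_cvg0.
    have fst_cvg : w.1 @[w --> (xb, 0 : X)] --> xb by exact: cvg_fst.
    exact: cvg_comp fst_cvg (C11_cvg F_C11).
  exact: Fc xiC.
have small := near_norm_snd ltr01.
near=> w => Q Qsym Qb TMw wmin.
have [Mw Tw] := TMw; have Ow := MO Mw.
have Uw : U w.1 by near: w.
have Tsub := tangent_space_linear Mcharts Mw.
have Qlb u : 0 * dotX u u <= dotX u (Q u) by rewrite mul0r; case/andP: (Qb u).
have Qub u : dotX u (Q u) <= A * dotX u u by case/andP: (Qb u).
have QA := quadratic_norm normX Qsym (lexx 0) Qlb Qub.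
have [xi [xi_sub xi_mult]] := multiplier basisZ vt_convex Tsub Qsym Tw wmin.
have [n [H [nE nS HE]]] := normal_vectors normX basisX Ssub chart Uw Mw xi_mult.
exists (subgradient dotX dotZ e d w.2 Q xi a H).
  exact: (subgradient_regular normX normZ basisX basisZ Oo fN f_fin
    f_C11.1 F_C11.1 Ssub chart a Uw Ow Mw Tw xi_sub nE nS HE).
have xi_le : `|xi| <= Cx by apply: (near xiC' w).
have w21 : `|w.2| <= 1 by near: w.
have dfw h : `|'d (f_real f) (w.1) h| <= Cf * `|h| by apply: (near fC' w).
have dFw h : `|'d F (w.1) h| <= CF * `|h| by apply: (near FC' w).
have dpsiw h : `|'d psi (phi w.1) h| <= CB * `|h| by apply: (near BC' w).
have d2w u h : `|'d (fun y => 'd phi y u) (w.1) h| <= CD * `|u| * `|h|.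
  by apply: (near DC' w).
have n_le : `|n| <= Cn.
  apply: (norm_le_of_dot normX Cn0); rewrite nE (le_trans (ler_norm _))//
    normrN.
  rewrite (le_trans (ler_normD _ _))// /Cn mulrDl lerD//.
    rewrite (le_trans (ler_normD _ _))// mulrDl lerD ?(grad_fE basisX)//.
    rewrite (le_trans (cauchy_schwarz normX _ _))// ler_wpM2r//.
    by rewrite (le_trans (QA _))// ler_piMr.
  rewrite (le_trans (cauchy_schwarz normZ _ _))// -mulrA ler_pM//.
have CHw0 : 0 <= CH * `|w.2| by rewrite !mulr_ge0.
have H_le : `|H| <= CH * `|w.2|.
  apply: (norm_le_of_dot normX CHw0); rewrite HE (le_trans (ler_norm _))//.
  rewrite (le_trans (cauchy_schwarz normX _ _))// /CH -!mulrA ler_pM//.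
  rewrite (le_trans (dpsiw _))// ler_wpM2l// mulrA.
  exact: d2w.
rewrite (le_trans (subgradient_dnorm normX normZ basisX basisZ xi a (QA _)
  H_le))//.
rewrite ler_wpM2r// lerD2r lerD2l ler_wpM2l//.
Unshelve. all: by end_near. Qed.

End LocalEstimates.

(** * Runs of the algorithm *)

(* Through the near-covering form of compactness, constants found near each
   point of K give a constant valid along the whole sequence; no uniformized KL
   inequality is needed. *)
Lemma uniform_along (R : realType) (X : normedModType R) (K : set X)
    (u y : nat -> X) (P : R -> nat -> Prop) :
  compact K -> (forall k, K (u k)) -> y @ \oo --> (0 : X) ->
  (forall C C' k, C <= C' -> P C k -> P C' k) ->
  (forall xb, K xb -> exists C (N : set (X * X)), nbhs (xb, 0 : X) N /\
     \forall k \near \oo, N (u k, y k) -> P C k) ->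
  exists2 C : R, 0 < C & \forall k \near \oo, P C k.
Proof.
move=> /compact_near_coveringP Kcov Ku y0 Pmono loc.
pose FF := filter_prod (nbhs \oo : set_system nat) (nbhs (+oo : set_system R)).
have : \near FF, K `<=` (fun i z => z = u i.1 -> P i.2 i.1) FF.
  apply: Kcov => xb Kxb.
  have [C [N [[[A B] /= [xbA B0] ABN] HN]]] := loc _ Kxb.
  exists (A, [set i : nat * R | B (y i.1) /\ (N (u i.1, y i.1) ->
    P C i.1) /\ C <= i.2]).
    split=> //=.
    exists ([set k | B (y k) /\ (N (u k, y k) -> P C k)], [set c | C <= c]).
      split=> /=; last exact: nbhs_pinfty_ge (num_real C).
      by apply: filterI => //; exact: y0.
    by move=> [k c] /= [[Byk Nk] Cc].
  move=> [z [k c]] /= [Az [Byk [Nk Cc]]] zE.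
  by apply: (Pmono _ _ _ Cc); apply: Nk; apply: ABN; split; rewrite //= -zE.
move=> [[A B] /= [A_oo B_oo] AB].
have [c [Bc c0]] : exists c : R, B c /\ 0 < c.
  have : \forall c \near (+oo : set_system R), B c /\ 0 < c.
    by apply: filterI => //; exact: nbhs_pinfty_gt (num_real 0).
  by move=> /filter_ex[c ?]; exists c.
exists c => //; apply: filterS A_oo => k Ak.
exact: (AB (k, c) (conj Ak Bc) (u k) (Ku k)).
Qed.

Lemma powRD_le (R : realType) (q s t : R) : 0 <= q <= 1 -> 0 <= s -> 0 <= t ->
  (s + t) `^ q <= 2 * (s `^ q + t `^ q).
Proof.
move=> /andP[q0 q1] s0 t0.
wlog st : s t s0 t0 / s <= t.
  move=> H; have [st|ts] := leP s t; first exact: H.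
  by rewrite [s + t]addrC [_ `^ q + _]addrC H// ltW.
apply: (@le_trans _ _ ((2 * t) `^ q)).
  apply: ge0_ler_powR; rewrite ?nnegrE ?addr_ge0 ?mulr_ge0//.
  by rewrite mulr_natl mulr2n lerD2r.
rewrite powRM//; apply: ler_pM; rewrite ?powR_ge0//.
  rewrite -[leRHS](powRr1 (ler0n R 2)); apply: ler_powR => //.
  by rewrite ler1n.
by rewrite lerDr powR_ge0.
Qed.

Section Run.
Variables (R : realType) (X Z : normedModType R).
Variables (dotX : {dot X for idfun}) (dotZ : {dot Z for idfun}).
Hypotheses (normX : norm_from dotX) (normZ : norm_from dotZ).
Variables (p r : nat) (e : 'I_p -> X) (d : 'I_r -> Z).
Hypotheses (basisX : orthonormal_basis dotX e) (basisZ : orthonormal_basis dotZ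
  d).
Variables (f : X -> \bar R) (vt : Z -> R) (F : X -> Z) (M O : set X).
Hypothesis assumptions : standing_assumptions f vt F M O.
Variable Ret : X -> X -> X.
Hypothesis Ret_retraction : retraction M Ret.
Variables (amin amax mumax abar gbar sigma : R).
Variables (x : nat -> X) (mu : nat -> R) (alpha : nat -> nat -> R).
Variables (Q : nat -> nat -> {linear X -> X}) (vbar v : nat -> nat -> X).
Variables (LB : nat -> nat -> R) (jend : nat -> nat).
Hypothesis run : RiVMPL_run dotX f vt F M Ret amin amax mumax abar gbar sigma
  x mu alpha Q vbar v LB jend.

Local Notation obj := (objective f vt F).
Local Notation modl := (model dotX f vt F).
Let Qk k := Q k (jend k).
Let vk k := v k (jend k).
Let vbk k := vbar k (jend k).

Let MO : M `<=` O. Proof. by have [_ []] := assumptions. Qed.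
Let vt_convex : convex_function setT vt. Proof. by case: assumptions. Qed.
Let Mcharts : C2_embedded_submanifold M. Proof. by have [[]] := assumptions.
  Qed.

Lemma iterate_in_manifold k : M (x k).
Proof.
elim: k => [|k IH]; first exact: run_x0 run.
rewrite (run_next run); have [RM _ _ _] := Ret_retraction; apply: RM.
by split=> //=; have [] := run_v run (leqnn (jend k)).
Qed.
Let Mx := iterate_in_manifold.

Lemma amin_le_alpha k j : (j <= jend k)%N -> amin <= alpha k j.
Proof.
elim: j => [_|j IH jk]; first by case/andP: (run_alpha0 run k).
have [_ _ ->] := run_continue run jk.
have a1 := IH (ltnW jk); rewrite (le_trans a1)// ler_peMl//.
  by rewrite (le_trans _ a1)// ltW// (run_amin run).
by rewrite ltW// (run_sigma run).
Qed.

Lemma tangent_vk k : tangent_space M (x k) (vk k).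
Proof. by have [] := run_v run (leqnn (jend k)). Qed.

Lemma tangent_vbk k : tangent_space M (x k) (vbk k).
Proof. by have [] := run_vbar run (leqnn (jend k)). Qed.

Lemma norm_vk_gt0 k : 0 < `|vk k|.
Proof. by rewrite lt_neqAle normr_ge0 andbT eq_sym (run_no_stop run). Qed.

Lemma model_zero k : modl (x k) (Qk k) 0 = obj (x k).
Proof.
by rewrite modelE !(linear0, linear0r, mulr0, addr0, add0r) addrC.
Qed.

Lemma objective_step k :
  obj (x k.+1) <= modl (x k) (Qk k) (vk k) - gbar / 2 * `|vk k| ^+ 2.
Proof.
have := run_exit run k; rewrite -(run_next run).
rewrite (ThetaE assumptions); last exact/MO/Mx.
by rewrite lee_fin => -[//|/eqP]; rewrite (negbTE (run_no_stop run k)).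
Qed.

Lemma objective_descent k :
  gbar / 2 * `|vk k| ^+ 2 <= obj (x k) - obj (x k.+1).
Proof.
have := objective_step k; have [_ _ + _] := run_v run (leqnn (jend k)).
by rewrite -/(Qk k) -/(vk k) model_zero; lra.
Qed.

Lemma objective_bounded_below : exists m, forall k, m <= obj (x k).
Proof.
have [_ _ _ _ [_ +]] := assumptions.
set I := ereal_inf _ => I_gt.
have Ile k : (I <= (obj (x k))%:E)%E.
  rewrite -(ThetaE assumptions); last exact/MO/Mx.
  by apply: ereal_inf_lbound; exists (x k) => //; exact: Mx.
move: I_gt Ile; case: I => [m _ Ile|_ Ile|//].
  by exists m => k; rewrite -lee_fin.
by have := Ile 0%N; rewrite leye_eq.
Qed.

Let sq_ge0 k : 0 <= gbar / 2 * `|vk k| ^+ 2.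
Proof. by rewrite mulr_ge0 ?sqr_ge0// divr_ge0// ltW// (run_gbar run). Qed.

Lemma objective_nonincreasing : nonincreasing_seq (obj \o x).
Proof.
apply/nonincreasing_seqP => k /=.
by have := objective_descent k; have := sq_ge0 k; lra.
Qed.

Let varsigma : R := limn (fun k => fine (Theta f vt F (x k)) : R^o).
Let gap k := fine (Theta f vt F (x k)) - varsigma.

Lemma fine_Theta k : fine (Theta f vt F (x k)) = obj (x k).
Proof. by rewrite (ThetaE assumptions)//; exact/MO/Mx. Qed.

Lemma objective_cvg : (fun k => obj (x k) : R^o) @ \oo --> (varsigma : R^o).
Proof.
rewrite /varsigma.
have -> : (fun k => fine (Theta f vt F (x k)) : R^o) = (fun k => obj (x k)).
  by apply/funext => k; exact: fine_Theta.
have [m mP] := objective_bounded_below.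
apply: (nonincreasing_is_cvgn objective_nonincreasing).
by exists m => _ [k _ <-]; exact: mP.
Qed.

Lemma gap_cvg : (gap : nat -> R^o) @ \oo --> (0 : R^o).
Proof.
have -> : gap = (fun k => obj (x k) - varsigma).
  by apply/funext => k; rewrite /gap fine_Theta.
rewrite -(subrr varsigma); apply: cvgB; [exact: objective_cvg|exact: cvg_cst].
Qed.

(** Strict because no step of an infinite run vanishes; negative powers of the gap can then be taken
    in the sublinear rate. *)
Lemma gap_gt0 k : 0 < gap k.
Proof.
rewrite /gap fine_Theta subr_gt0.
have obj_ge j : varsigma <= obj (x j).
  have cvgo : cvgn (obj \o x : nat -> R^o) by apply/cvg_ex; exists varsigma;
    exact: objective_cvg.
  rewrite -(cvg_lim (@norm_hausdorff R R^o) objective_cvg).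
  exact: (nonincreasing_cvgn_ge objective_nonincreasing cvgo).
apply: le_lt_trans (obj_ge k.+1) _.
have := objective_descent k; rewrite -subr_gt0 => h; apply: lt_le_trans h.
rewrite mulr_gt0 ?exprn_gt0 ?norm_vk_gt0// divr_gt0//; exact: run_gbar run.
Qed.

Lemma gap_descent k : gbar / 2 * `|vk k| ^+ 2 <= gap k - gap k.+1.
Proof.
rewrite /gap !fine_Theta; have := objective_descent k.
by lra.
Qed.

Lemma quadratic_bounds k u :
  amin * dotX u u <= dotX u (Qk k u) <= (abar + alpha k (jend k)) * dotX u u.
Proof.
have /andP[lb ub] := run_Qbounds run (leqnn (jend k)) u.
rewrite ub andbT (le_trans _ lb)// ler_wpM2r ?dot_ge0//.
exact: amin_le_alpha.
Qed.

Lemma inexactness k :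
  modl (x k) (Qk k) (vk k) - modl (x k) (Qk k) (vbk k) <=
  mumax / 2 * `|vk k| ^+ 2.
Proof.
have [_ LBle _ gapLB] := run_v run (leqnn (jend k)).
have /andP[_ muk] := run_mu run k.
have : mu k / 2 * `|vk k| ^+ 2 <= mumax / 2 * `|vk k| ^+ 2.
  by rewrite ler_wpM2r ?sqr_ge0// ler_wpM2r.
move: LBle gapLB; rewrite -/(Qk k) -/(vk k) -/(vbk k).
by lra.
Qed.

Lemma minimizer_dist : exists2 C : R, 0 <= C & forall k, `|vbk k| <=
  C * `|vk k|.
Proof.
have amin0 := run_amin run; have mu0 := run_mumax run.
(* The modulus of [strong_convexity] for the lower bound [amin], common to all iterations; [B] is
   its ratio to the inexactness constant. *)
pose c := amin / 4; have c0 : 0 < c by rewrite divr_gt0.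
pose B := (mumax / 2) / c; have B0 : 0 <= B by rewrite !divr_ge0 ?ltW.
exists (1 + Num.sqrt B); first by rewrite addr_ge0// sqrtr_ge0.
move=> k; have Tsub := tangent_space_linear normX basisX Mcharts (Mx k).
have [_ vmin] := run_vbar run (leqnn (jend k)).
have Qlb u : amin * dotX u u <= dotX u (Qk k u) by case/andP: (quadratic_bounds
  k u).
have := strong_convexity normX vt_convex Tsub (run_Qsym run (leqnn _)) Qlb
  (tangent_vbk k) vmin (tangent_vk k).
rewrite -/c => h; have {}h := le_trans h (inexactness k).
have h2 : `|vk k - vbk k| <= Num.sqrt B * `|vk k|.
  rewrite -(@ler_pXn2r _ 2)// ?nnegrE ?mulr_ge0 ?sqrtr_ge0// exprMn sqr_sqrtr//.
  by rewrite -(ler_pM2l c0) (le_trans h)// [leRHS]mulrA [c * B]mulrC divfK//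
    gt_eqF.
rewrite -[vbk k](subKr (vk k)) (le_trans (ler_normB _ _))//.
by rewrite mulrDl mul1r lerD2l.
Qed.

Lemma vk_cvg0 : vk @ \oo --> (0 : X).
Proof.
have g2 : 0 < gbar / 2 by rewrite divr_gt0//; exact: run_gbar run.
apply/cvgrPdist_le => eps eps0; near=> k.
rewrite sub0r normrN -(@ler_pXn2r _ 2)// ?nnegrE ?(ltW eps0)//.
rewrite -(ler_pM2l g2); apply: le_trans (gap_descent k) _.
have := gap_gt0 k.+1; have : gap k <= gbar / 2 * eps ^+ 2.
  rewrite -[gap k]ger0_norm ?(ltW (gap_gt0 k))// -normrN -[- _]add0r.
  near: k; apply: cvgr_dist_le; first exact: gap_cvg.
  exact: (mulr_gt0 g2 (exprn_gt0 2 eps0)).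
by lra.
Unshelve. all: by end_near. Qed.

Lemma vbk_cvg0 : vbk @ \oo --> (0 : X).
Proof.
have [C C0 Cle] := minimizer_dist.
apply/cvgrPdist_le => eps eps0; near=> k.
rewrite sub0r normrN (le_trans (Cle k))// (@le_trans _ _ ((C + 1) * `|vk k|))//.
  by rewrite ler_wpM2r// lerDl.
rewrite -ler_pdivlMl ?ltr_wpDl// -[`|_|]normrN -[- _]sub0r.
near: k; apply: cvgr_dist_le; first exact: vk_cvg0.
by rewrite mulr_gt0// invr_gt0 ltr_wpDl.
Unshelve. all: by end_near. Qed.

(** * Bounded runs: step lengths and the KL estimate *)

Hypothesis x_bounded : bounded_set (range x).

Lemma iterates_in_compact : exists K : set X,
  [/\ compact K, K `<=` M & forall k, K (x k)].
Proof.
have [B [_ Bx]] := x_bounded.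
exists (M `&` [set y | `|y| <= B + 1]); split.
- apply: (fin_bounded_closed_compact normX basisX).
    exists (B + 1); split; first by rewrite num_real.
    by move=> c Bc y /= [_ yB]; rewrite (le_trans yB)// ltW.
  apply: closedI; first by have [[]] := assumptions.
  rewrite -[[set y | _]]/((fun y : X => `|y|) @^-1` [set c : R | c <= B + 1]).
  apply: closed_comp; last exact: closed_le.
  by move=> y _; exact: norm_continuous.
- by move=> y [].
- move=> k; split; first exact: Mx.
  by apply: (Bx (B + 1)); [rewrite ltrDl|exists k].
Qed.

Lemma step_le : exists2 C : R, 0 < C &
  \forall k \near \oo, `|x k.+1 - x k| <= C * `|vk k|.
Proof.
have [K [Kcompact KM Kx]] := iterates_in_compact.
apply: (uniform_along (P := fun C k => `|x k.+1 - x k| <= C * `|vk k|)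
  Kcompact Kx vk_cvg0).
  by move=> C C' k CC' h; rewrite (le_trans h)// ler_wpM2r.
move=> xb Kxb.
have T0 y : M y -> tangent_bundle M (y, 0).
  by move=> My; split=> //=; have [] := tangent_space_linear normX basisX
    Mcharts My.
have [C C0 HC] := retraction_lipschitz normX basisX Ret_retraction (T0 _ (KM _
  Kxb)).
exists C, [set w : X * X | tangent_bundle M w -> tangent_bundle M (w.1, 0) ->
    `|Ret w.1 w.2 - w.1| <= C * `|w.2|]; split => //.
near=> k => /= H; rewrite (run_next run); apply: H; last exact: T0.
by split=> /=; [exact: Mx|exact: tangent_vk].
Unshelve. all: by end_near. Qed.

Variables (balpha q : R).
Hypothesis balpha_gt0 : 0 < balpha.
Hypothesis balphaP : forall k j, (j <= jend k)%N -> alpha k j <= balpha.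
Hypothesis q_range : 2^-1 <= q < 1.

Let astar := balpha + abar.
Let Xi := potential dotX f vt F M e d astar.
Let w k := potential_iterate dotX dotZ f F e d (x k) (vbk k).
Let pdot := potential_dot dotX (p := p) (r := r).

Let astar_ge0 : 0 <= astar.
Proof. by rewrite addr_ge0 ?ltW//; exact: run_abar run. Qed.

Let value k := potential_value f vt F astar (x k) (vbk k).

Lemma XiE k : Xi (w k) = (value k)%:E.
Proof.
rewrite /Xi /w (potential_iterateE normX basisX basisZ assumptions)//.
by split=> /=; [exact: Mx|exact: tangent_vbk].
Qed.

Lemma quadratic_bounds_astar k u : 0 <= dotX u (Qk k u) <= astar * dotX u u.
Proof.
have /andP[lb ub] := quadratic_bounds k u; apply/andP; split.
  by rewrite (le_trans _ lb)// mulr_ge0 ?dot_ge0// ltW//; exact: run_amin run.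
rewrite (le_trans ub)// ler_wpM2r ?dot_ge0// /astar addrC lerD2r.
exact: balphaP (leqnn _).
Qed.

(** The exit test bounds the next objective by the model at [vk], inexactness passes to the model at
    [vbk], and [astar] dominates the quadratic term there. *)
Lemma gap_le_value k : gap k.+1 <= (value k - varsigma) + mumax / 2 * `|vk k|
  ^+ 2.
Proof.
have /andP[_ ub] := quadratic_bounds_astar k (vbk k).
have := objective_step k; have := inexactness k; have := sq_ge0 k.
rewrite /gap fine_Theta (modelE dotX f vt F (x k) (Qk k) (vbk k)) (grad_fE
  basisX).
rewrite (dot_norm normX) in ub.
by rewrite /value /potential_value; lra.
Qed.

Lemma cluster_objective xb : M xb -> cluster (x @ \oo) xb -> obj xb = varsigma.
Proof.
move=> Mxb clu; apply/eqP; rewrite -subr_eq0 -normr_le0.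
apply/ler_addgt0Pr => eps eps0; rewrite add0r.
have e2 : 0 < eps / 2 by rewrite divr_gt0.
have objc : (fun y => obj y : R^o) @ xb --> (obj xb : R^o).
  apply: cvgD.
    by apply: (C11_cvg assumptions Mxb); have [_ _ []] := assumptions.
  have Fc : F @ xb --> F xb.
    by apply: (C11_cvg assumptions Mxb); have [_ _ _ _ []] := assumptions.
  exact: cvg_comp Fc (convex_continuous normZ basisZ vt_convex (x := _)).
have A : \forall k \near \oo, `|varsigma - obj (x k) : R^o| <= eps / 2.
  by apply: cvgr_dist_le e2; exact: objective_cvg.
have B : \forall y \near xb, `|obj xb - obj y : R^o| <= eps / 2.
  by apply: cvgr_dist_le e2; exact: objc.
have [y [/= h1 h2]] := clu [set y | `|varsigma - obj y| <= eps / 2] _ A B.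
rewrite (le_trans (ler_distD (obj y) _ _))// [eps]splitr lerD//.
by rewrite distrC.
Qed.

Hypothesis KL : forall wbar, cluster (w @ \oo) wbar ->
  KL_property pdot q Xi wbar.

Lemma cluster_iterate xb : M xb -> cluster (x @ \oo) xb ->
  cluster (w @ \oo) (potential_iterate dotX dotZ f F e d xb 0).
Proof.
move=> Mxb clu A B wA /nbhs_ballP[rho /= rho0 rhoB].
(* [iterate_near] gives a weak inequality; halving the radius makes it strict. *)
have rho2 : 0 < rho / 2 by rewrite divr_gt0.
have [[D E] /= [xbD E0] DE] :=
  iterate_near normX normZ basisX basisZ assumptions Mxb rho2.
have xA : (x @ \oo) [set x k | k in [set k | A (w k) /\ E (vbk k)]].
  have : \forall k \near \oo, A (w k) /\ E (vbk k).
    by apply: filterI; [exact: wA|exact: vbk_cvg0].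
  by apply: filterS => k Ak; exists k.
have [_ [[k [Ak Ek] <-] Dk]] := clu _ _ xA xbD.
exists (w k); split=> //; apply: rhoB; rewrite -ball_normE /ball_/= distrC.
apply: le_lt_trans (potential_norm_le normX _) _.
apply: le_lt_trans (DE (x k, vbk k) _) _; first by split.
by rewrite ltr_pdivrMr// ltr_pMr// ltr1n.
Qed.

Lemma KL_le : exists2 C : R, 0 < C &
  \forall k \near \oo, gap k.+1 `^ q <= C * `|vk k|.
Proof.
have q_gt0 : 0 < q by move: q_range; lra.
have q1 : 0 < 1 - q by move: q_range; lra.
have [K [Kcompact KM Kx]] := iterates_in_compact.
apply: (uniform_along (P := fun C k => gap k.+1 `^ q <= C * `|vk k|)
  Kcompact Kx vbk_cvg0).
  by move=> C C' k CC' h; rewrite (le_trans h)// ler_wpM2r.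
move=> xb Kxb; have Mxb := KM _ Kxb.
have [clu|nclu] := pselect (cluster (x @ \oo) xb); last first.
  (* The KL hypothesis concerns cluster points only. Any other point has a neighbourhood that the
     iterates eventually avoid, so the local claim is vacuous and the constant 0 serves. *)
  have [A [B [xA xbB AB]]] : exists A B, [/\ (x @ \oo) A,
    nbhs xb B & ~ (A `&` B !=set0)].
    apply: contrapT => noAB; apply: nclu => A B xA xbB.
    by apply: contrapT => AB; apply: noAB; exists A, B.
  exists 0, (B `*` setT); split.
    by exists (B, setT); [split=> //; exact: filterT|].
  have {}xA : \forall k \near \oo, A (x k) by exact: xA.
  by apply: filterS xA => k Ak [Bk _]; case: AB; exists (x k).
have [Cv Cv0 vble] := minimizer_dist.
have [Cs Cs0 sub] := subgradient_near normX normZ basisX basisZ assumptions Mxb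
  astar astar_ge0.
have [_ [c [delta [varpi [c0 delta0 varpi0 KLx]]]]] :=
  KL (cluster_iterate Mxb clu).
have objE := cluster_objective Mxb clu.
have T0 : tangent_bundle M (xb, 0).
  by split=> //=; have [] := tangent_space_linear normX basisX Mcharts Mxb.
have XibE : Xi (potential_iterate dotX dotZ f F e d xb 0) = varsigma%:E.
  rewrite /Xi (potential_iterateE normX basisX basisZ assumptions)// -objE.
  by rewrite /potential_value !linear0 !addr0 normr0 expr0n mulr0 addr0.
rewrite XibE in KLx.
(* The window [varpi] may be infinite; a positive real below it is enough. *)
have [eps eps0 epsv] : exists2 eps : R, 0 < eps & (eps%:E <= varpi)%E.
  move: varpi0; case: (varpi) => [s|_|//]; first by rewrite lte_fin; exists s.
  by exists 1 => //; rewrite leey.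
have near1 := iterate_near normX normZ basisX basisZ assumptions Mxb delta0.
have near2 : \forall y \near (xb, 0 : X),
    potential_value f vt F astar y.1 y.2 < varsigma + eps.
  have /cvgrPdist_lt/(_ _ eps0) cv :=
    potential_value_cvg normX normZ basisX basisZ assumptions Mxb astar.
  near=> y; have : `|obj xb - potential_value f vt F astar y.1 y.2 : R^o| < eps.
    by near: y; exact: cv.
  by rewrite objE distrC => /ltr_distlDr; rewrite addrC.
(* The factor of the inexactness error after raising to the power [q]; the 2 in the constant below
   is that of [powRD_le]. *)
pose B := (mumax / 2) `^ q.
exists (2 * (c * (1 - q) * (Cs * Cv) + B)).
exists [set w : X * X | [/\ dnorm pdot (potential_iterate dotX dotZ f F e d w.1
  w.2
    - potential_iterate dotX dotZ f F e d xb 0) <= delta,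
    potential_value f vt F astar w.1 w.2 < varsigma + eps &
    forall Q : {linear X -> X},
    (forall u u', dotX (Q u) u' = dotX u (Q u')) ->
    (forall u, 0 <= dotX u (Q u) <= astar * dotX u u) ->
    tangent_bundle M w ->
    (forall u, tangent_space M w.1 u ->
       model dotX f vt F w.1 Q w.2 <= model dotX f vt F w.1 Q u) ->
    exists2 s, regular_subdiff pdot Xi (potential_iterate dotX dotZ f F e d w.1
      w.2) s &
      dnorm pdot s <= Cs * `|w.2|] ]; split.
  by near=> y; split; near: y.
have vk1 : \forall k \near \oo, `|vk k| <= 1.
  near=> k; rewrite -[`|_|]normrN -[- _]sub0r.
  by near: k; apply: cvgr_dist_le; first exact: vk_cvg0.
near=> k => -[/= dist_le val_lt subk].
have [_ vmin] := run_vbar run (leqnn (jend k)).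
have TMk : tangent_bundle M (x k, vbk k) by split=> /=;
  [exact: Mx|exact: tangent_vbk].
have [s s_reg s_le] := subk (Qk k) (run_Qsym run (leqnn _))
  (quadratic_bounds_astar k) TMk vmin.
have vk01 : 0 < `|vk k| <= 1 by rewrite norm_vk_gt0/=; near: k.
have mumax0 : 0 <= mumax / 2 by rewrite divr_ge0// ltW//; exact: run_mumax run.
have sq_le : (mumax / 2 * `|vk k| ^+ 2) `^ q <= B * `|vk k|.
  rewrite powRM// ?sqr_ge0// ler_wpM2l ?powR_ge0//.
  rewrite -powR_mulrn// -powRrM -[leRHS](powRr1 (normr_ge0 _)).
  by apply: ger_powR => //; move: q_range; lra.
have KLC0 : 0 <= c * (1 - q) * (Cs * Cv) by rewrite !mulr_ge0// ltW.
(* The maximum with 0 covers the values at or below [varsigma], to which the KL inequality does not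
   apply. *)
have value_le : Num.max 0 (value k - varsigma) `^ q <=
  c * (1 - q) * (Cs * Cv) * `|vk k|.
  have [vle|vgt] := leP (value k) varsigma.
    rewrite (max_idPl _) ?subr_le0// powR0 ?gt_eqF// mulr_ge0//.
  rewrite (max_idPr _) ?subr_ge0 ?(ltW vgt)//.
  have := KLx (w k) dist_le; rewrite XiE lte_fin => /(_ vgt).
  have -> : ((value k)%:E < varsigma%:E + varpi)%E.
    by rewrite (lt_le_trans _ (leeD2l _ epsv))// -EFinD lte_fin.
  move=> /(_ isT); rewrite -EFinB /= => KLk.
  have dist0_le : (dist0_subdiff pdot Xi (w k) <= (dnorm pdot s)%:E)%E.
    apply: ereal_inf_lbound; exists s => //; split; first by rewrite XiE.
    (* Constant sequences show that a regular subgradient is a limiting one. *)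
    exists (fun=> w k), (fun=> s); split=> //; exact: cvg_cst.
  have c1 : 0 <= c * (1 - q) by rewrite mulr_ge0// ltW.
  have c1E : (0%:E <= (c * (1 - q))%:E)%E by rewrite lee_fin.
  have := le_trans KLk (lee_wpmul2l c1E dist0_le).
  rewrite -EFinM lee_fin => h; apply: le_trans h _.
  rewrite -[leRHS]mulrA ler_wpM2l// (le_trans s_le)//.
  by rewrite -mulrA ler_wpM2l.
have -> : 2 * (c * (1 - q) * (Cs * Cv) + B) * `|vk k| =
    2 * (c * (1 - q) * (Cs * Cv) * `|vk k| + B * `|vk k|) by ring.
have m0 : 0 <= Num.max 0 (value k - varsigma) by rewrite le_max lexx.
have sq0 : 0 <= mumax / 2 * `|vk k| ^+ 2 by rewrite mulr_ge0 ?sqr_ge0.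
have gap_le : gap k.+1 <= Num.max 0 (value k - varsigma) + mumax / 2 * `|vk k|
  ^+ 2.
  by rewrite (le_trans (gap_le_value k))// lerD2r le_max lexx orbT.
apply: (@le_trans _ _ ((Num.max 0 (value k - varsigma) + mumax / 2 * `|vk k| ^+
  2) `^ q)).
  apply: ge0_ler_powR => //; first exact: ltW.
    by rewrite nnegrE; apply: ltW; exact: gap_gt0.
  by rewrite nnegrE addr_ge0.
have q01 : 0 <= q <= 1 by move: q_range; lra.
apply: le_trans (powRD_le q01 m0 sq0) _.
by rewrite ler_wpM2l// lerD.
Unshelve. all: by end_near. Qed.

Lemma exists_cluster : exists xs, cluster (x @ \oo) xs.
Proof.
have [K [Kcompact _ Kx]] := iterates_in_compact.
have xK : (x @ \oo) K by exists 0%N => // k _; exact: Kx.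
have [xs [_ clu]] := Kcompact (x @ \oo) _ xK.
by exists xs.
Qed.

End Run.

Theorem theorem5p3 (R : realType) (X Z : normedModType R)
  (dotX : {dot X for idfun}) (dotZ : {dot Z for idfun})
  (normX : norm_from dotX) (normZ : norm_from dotZ)
  (p r : nat) (e : 'I_p -> X) (d : 'I_r -> Z)
  (basisX : orthonormal_basis dotX e) (basisZ : orthonormal_basis dotZ d)
  (f : X -> \bar R) (vt : Z -> R) (F : X -> Z) (M O : set X)
  (assumptions : standing_assumptions f vt F M O)
  (Ret : X -> X -> X) (Ret_retraction : retraction M Ret)
  (amin amax mumax abar gbar sigma : R)
  (x : nat -> X) (mu : nat -> R) (alpha : nat -> nat -> R)
  (Q : nat -> nat -> {linear X -> X}) (vbar v : nat -> nat -> X)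
  (LB : nat -> nat -> R) (jend : nat -> nat)
  (run : RiVMPL_run dotX f vt F M Ret amin amax mumax abar gbar sigma
           x mu alpha Q vbar v LB jend)
  (x_bounded : bounded_set (range x))
  (balpha : R) (balpha_gt0 : 0 < balpha)
  (balphaP : forall k j, (j <= jend k)%N -> alpha k j <= balpha)
  (q : R) (q_range : 2^-1 <= q < 1) :
  let Xi := potential dotX f vt F M e d (balpha + abar) in
  let w := fun k : nat =>
    potential_iterate dotX dotZ f F e d (x k) (vbar k (jend k)) in
  let Wstar := cluster (w @ \oo) in
  let Omega := cluster (x @ \oo) in
  let varsigma : R := limn (fun k => fine (Theta f vt F (x k)) : R^o) in
  let gap := fun k : nat => fine (Theta f vt F (x k)) - varsigma in
  (forall wbar, Wstar wbar ->
     KL_property (potential_dot dotX (p := p) (r := r)) q Xi wbar) ->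
  exists xstar : X,
    [/\ Omega xstar, x @ \oo --> xstar,
      (q = 2^-1 ->
         exists rho rhohat gamma1 : R,
           [/\ 0 < rho < 1, 0 < rhohat < 1, 0 < gamma1 &
             \forall k \near \oo,
               gap k <= rho * gap k.-1 /\
               `|x k - xstar| <= gamma1 * rhohat ^+ k]) &
      (2^-1 < q ->
         exists gamma1 gamma2 : R,
           [/\ 0 < gamma1, 0 < gamma2 &
             \forall k \near \oo,
               gap k <= gamma1 * k%:R `^ (1 / (1 - 2 * q)) /\
               `|x k - xstar| <= gamma2 * k%:R `^ ((1 - q) / (1 - 2 * q))])].
Proof.
move=> Xi w Wstar Omega varsigma gap KL.
have [xs clu] := exists_cluster normX basisX assumptions Ret_retraction run x_bounded.
have [C C0 KLC] := KL_le normX normZ basisX basisZ assumptions Ret_retraction run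
  x_bounded balpha_gt0 balphaP q_range KL.
have [L L0 stepL] := step_le normX basisX assumptions Ret_retraction run x_bounded.
have gbar2 : 0 < gbar / 2 by rewrite divr_gt0//; exact: run_gbar run.
have [x_cvg half sublin] := convergence_rates q_range gbar2 C0 (ltW L0)
  (gap_gt0 assumptions Ret_retraction run) (fun k => normr_ge0 (v k (jend k)))
  (gap_descent assumptions Ret_retraction run)
  (gap_cvg assumptions Ret_retraction run) KLC stepL clu.
by exists xs; split.
Qed.
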